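(* There is an algorithm which, given integers $3\le a\le b\le c\le d$, constructs in $O(d)$ steps a connected graph $G$ with $g(G)=a$, $eg(G)=b$, $seg(G)=c$ and $meg(G)=d$.
   Context: All graphs are finite, simple, undirected and connected. A step is an elementary operation of building the graph, such as adding one vertex or one edge; the constant in $O(d)$ is absolute (independent of $a,b,c,d$). Let $G$ be a graph with vertex set $V(G)$ and edge set $E(G)$. - A geodetic set of $G$ is a set $S\subseteq V(G)$ such that every vertex of $G$ lies on some (at least one) shortest path between some pair of distinct vertices of $S$. The geodetic number $g(G)$ is the minimum cardinality of a geodetic set. - An edge-geodetic set of $G$ is a set $S\subseteq V(G)$ such that every edge of $G$ lies on some (at least one) shortest path between some pair of distinct vertices of $S$. The edge-geodetic number $eg(G)$ is the minimum cardinality of an edge-geodetic set. - A strong edge-geodetic set of $G$ is a set $S\subseteq V(G)$ for which one can choose, for each unordered pair of distinct vertices $u,v\in S$, one specific shortest $u$--$v$ path $P_{uv}$, such that every edge of $G$ lies on at least one of the chosen paths. The strong edge-geodetic number $seg(G)$ is the minimum cardinality of a strong edge-geodetic set. - A monitoring edge-geodetic set (MEG-set) of $G$ is a set $S\subseteq V(G)$ such that for every edge $e\in E(G)$ there is a pair of distinct vertices $u,v\in S$ such that $e$ lies on every shortest $u$--$v$ path in $G$. The monitoring edge-geodetic number $meg(G)$ is the minimum cardinality of an MEG-set. *)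

(* Defs.v *)
From mathcomp Require Import all_boot.

Set Implicit Arguments.
Unset Strict Implicit.
Unset Printing Implicit Defensive.

Record sgraph := SGraph {
  vertex :> finType;
  adj : rel vertex;
  adj_sym : symmetric adj;
  adj_irr : irreflexive adj
}.

Definition connected (G : sgraph) : Prop :=
  0 < #|G| /\ forall x y : G, connect (@adj G) x y.

(* The list of all vertices visited, both ends included. *)
Definition walk (G : sgraph) (u v : G) (s : seq G) : bool :=
  if s is x :: p then [&& x == u, path (@adj G) x p & last x p == v] else false.

(* Minimality is taken among walks: a walk of minimum length has no repeated
   vertex, so these are exactly the shortest paths. *)
Definition geodesic (G : sgraph) (u v : G) (s : seq G) : Prop :=
  walk u v s /\ forall s', walk u v s' -> size s <= size s'.

Definition edge_on (G : sgraph) (x y : G) (s : seq G) : bool :=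
  infix [:: x; y] s || infix [:: y; x] s.

Definition geodetic_set (G : sgraph) (S : {set G}) : Prop :=
  forall x : G, exists u v s,
    [/\ u \in S, v \in S, u != v, geodesic u v s & x \in s].

Definition edge_geodetic_set (G : sgraph) (S : {set G}) : Prop :=
  forall x y : G, adj x y -> exists u v s,
    [/\ u \in S, v \in S, u != v, geodesic u v s & edge_on x y s].

(* The equation [P v u = rev (P u v)] makes [P] a choice of one path per
   unordered pair. *)
Definition strong_edge_geodetic_set (G : sgraph) (S : {set G}) : Prop :=
  exists P : G -> G -> seq G,
    (forall u v, u \in S -> v \in S -> u != v ->
       geodesic u v (P u v) /\ P v u = rev (P u v)) /\
    (forall x y : G, adj x y -> exists u v,
       [/\ u \in S, v \in S, u != v & edge_on x y (P u v)]).

Definition meg_set (G : sgraph) (S : {set G}) : Prop :=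
  forall x y : G, adj x y -> exists u v,
    [/\ u \in S, v \in S, u != v &
        forall s, geodesic u v s -> edge_on x y s].

Definition min_card (T : finType) (P : {set T} -> Prop) (k : nat) : Prop :=
  (exists2 S, P S & #|S| = k) /\ (forall S, P S -> k <= #|S|).

Definition geodetic_number (G : sgraph) (k : nat) : Prop :=
  min_card (@geodetic_set G) k.
Definition edge_geodetic_number (G : sgraph) (k : nat) : Prop :=
  min_card (@edge_geodetic_set G) k.
Definition strong_edge_geodetic_number (G : sgraph) (k : nat) : Prop :=
  min_card (@strong_edge_geodetic_set G) k.
Definition meg_number (G : sgraph) (k : nat) : Prop :=
  min_card (@meg_set G) k.

(* A graph under construction: the vertices are 0, ..., order - 1. *)
Record build := Build { order : nat; edges : seq (nat * nat) }.

Definition add_vertex (b : build) : build := Build (order b).+1 (edges b).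

(* Requests that would not yield an edge of a simple graph are ignored. *)
Definition add_edge (i j : nat) (b : build) : build :=
  if [&& i < order b, j < order b & i != j]
  then Build (order b) ((i, j) :: edges b) else b.

Definition build_adj (b : build) : rel 'I_(order b) := fun x y =>
  (x != y) && (((x : nat, y : nat) \in edges b) ||
               ((y : nat, x : nat) \in edges b)).

Lemma build_adj_sym (b : build) : symmetric (@build_adj b).
Proof. by move=> x y; rewrite /build_adj eq_sym orbC. Qed.

Lemma build_adj_irr (b : build) : irreflexive (@build_adj b).
Proof. by move=> x; rewrite /build_adj eqxx. Qed.

Definition graph_of (b : build) : sgraph :=
  SGraph (@build_adj_sym b) (@build_adj_irr b).

Inductive expr :=
| Const of nat
| Reg of nat
| Add of expr & expr
| Sub of expr & expr.

Definition store := nat -> nat.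

Fixpoint eval (m : store) (e : expr) : nat :=
  match e with
  | Const k => k
  | Reg r => m r
  | Add e1 e2 => eval m e1 + eval m e2
  | Sub e1 e2 => eval m e1 - eval m e2
  end.

(* Algorithms are programs of a while-language over registers holding natural
   numbers, extended with instructions that build a graph.  A test [e] succeeds
   when the value of [e] is nonzero; as subtraction is truncated,
   [Sub e2 e1] tests e1 < e2. *)
Inductive program :=
| Skip
| Assign of nat & expr
| AddVertex
| AddEdge of expr & expr
| Seq of program & program
| If of expr & program & program
| While of expr & program.

Definition update (m : store) (r k : nat) : store :=
  fun r' => if r' == r then k else m r'.

(* [exec p m b t m' b']: run from registers [m] and graph [b], [p] halts in
   [t] steps with registers [m'] and graph [b'].  Besides the additions of a
   vertex or of an edge, every assignment and every test counts as a step. *)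
Inductive exec : program -> store -> build -> nat -> store -> build -> Prop :=
| ExecSkip m b : exec Skip m b 0 m b
| ExecAssign r e m b : exec (Assign r e) m b 1 (update m r (eval m e)) b
| ExecAddVertex m b : exec AddVertex m b 1 m (add_vertex b)
| ExecAddEdge e1 e2 m b :
    exec (AddEdge e1 e2) m b 1 m (add_edge (eval m e1) (eval m e2) b)
| ExecSeq p1 p2 m b t1 m1 b1 t2 m2 b2 :
    exec p1 m b t1 m1 b1 -> exec p2 m1 b1 t2 m2 b2 ->
    exec (Seq p1 p2) m b (t1 + t2) m2 b2
| ExecIfTrue e p1 p2 m b t m' b' :
    eval m e != 0 -> exec p1 m b t m' b' -> exec (If e p1 p2) m b t.+1 m' b'
| ExecIfFalse e p1 p2 m b t m' b' :
    eval m e = 0 -> exec p2 m b t m' b' -> exec (If e p1 p2) m b t.+1 m' b'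
| ExecWhileTrue e p m b t1 m1 b1 t2 m2 b2 :
    eval m e != 0 -> exec p m b t1 m1 b1 ->
    exec (While e p) m1 b1 t2 m2 b2 ->
    exec (While e p) m b (t1 + t2).+1 m2 b2
| ExecWhileFalse e p m b :
    eval m e = 0 -> exec (While e p) m b 1 m b.

(* On input [args], the registers initially hold [args], then zeros, and the
   graph is empty. *)
Definition constructs_in (p : program) (args : seq nat) (t : nat)
    (G : sgraph) : Prop :=
  exists m b, exec p (nth 0 args) (Build 0 [::]) t m b /\ G = graph_of b.

(* Main.v *)
Require Import Defs.
From HB Require Import structures.
From mathcomp Require Import all_boot zify.

(** Put q = a - 2, k = b - a, n = c - b + 2, f = ceil((d - c) / 2). The graph is
    a row of hubs H_0, ..., H_{f+1}. Consecutive hubs H_i, H_{i+1} are joined by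
    parallel strands H_i - Near i j - Far i j - H_{i+1} of length 3: two strands
    when i < f, and n of them in the last stage i = f. The vertex Far f 0 carries
    q pendant leaves; k chords are adjacent to Near f 0, Far f 0 and H_{f+1}; and
    if d - c is even a pendant tail hangs at H_0. The root is the tail if there
    is one, and H_0 otherwise.

    - Leaves lie in every geodetic set; some vertex below H_f is needed to cover
      the root, and some vertex above H_f other than a leaf or a chord to cover a
      strand of the last stage. The root, H_{f+1} and the leaves suffice: g = q + 2 = a.
    - Each chord has its closed neighbourhood inside that of Far f 0, so it lies
      in every edge-geodetic set; adding the chords suffices: eg = a + k = b.
    - A last-stage strand j > 0 that contains no chosen vertex can only be
      covered by a path from some chosen vertex x at or below H_f to the chosen
      vertex H_{f+1}, and each x has one such path. So if u strands are avoided,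
      u > 0, then u low vertices and H_{f+1} are chosen; if none is avoided, one
      low vertex is still needed. Either way the n - 1 strands cost n, on top of
      the leaves and the chords: seg = q + k + n = c. The early stages are free,
      since two paths from the root cover their pairs of strands.
    - For monitoring, a strand that avoids the set has a detour of the same
      length, so every strand except the one with the leaves must be met. The
      early stages now cost two vertices each, the tail one, and
      meg = [tail] + 2f + q + k + n - 1 = d.

    [strong_lower] and [strand_hit] carry the last two bounds,
    [right_monitored] and [track] the constructions that attain them. All upper
    bounds rest on a level function: a walk that climbs one level at each step
    is a geodesic, and between its ends there are no other geodesics than
    climbing walks. *)

Set Implicit Arguments.
Unset Strict Implicit.
Unset Printing Implicit Defensive.

(** * Walks and geodesics *)

Section Geodesics.
Variable G : sgraph.
Implicit Types (u v x y a b : G) (s m p : seq G) (S : {set G}).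

Lemma walkP u v s :
  reflect (exists p, [/\ s = u :: p, path (@adj G) u p & last u p = v])
          (walk u v s).
Proof.
apply: (iffP idP) => [|[p [-> Hp Hl]]]; last by rewrite /= eqxx Hp Hl eqxx.
by case: s => //= x p /and3P[/eqP-> Hp /eqP Hl]; exists p.
Qed.

Lemma walk_cons u v x p : walk u v (x :: p) -> x = u.
Proof. by case/and3P=> /eqP. Qed.

Lemma walk_last u v s x : walk u v (rcons s x) -> x = v.
Proof.
by case: s => [|y s] /and3P[_ _ /eqP <-] //; rewrite last_rcons.
Qed.

Lemma walk_rev u v s : walk u v s -> walk v u (rev s).
Proof.
case/walkP=> p [-> Hp <-]; apply/walkP; exists (rev (belast u p)).
rewrite rev_path (eq_path (e' := @adj G)) //; last first.
  by move=> x y /=; rewrite adj_sym.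
split=> //; first by rewrite lastI rev_rcons.
by case: p {Hp} => //= y p; rewrite rev_cons last_rcons.
Qed.

Lemma walk_cat u v w s p :
  walk u v s -> walk v w (v :: p) -> walk u w (s ++ p).
Proof.
case/walkP=> p1 [-> Hp1 Hl] /walkP[p2 [[<-] Hp2 Hw]].
by apply/walkP; exists (p1 ++ p); rewrite cat_path last_cat Hl Hp1.
Qed.

Lemma walk_subst u v a b s1 m m' s2 :
  walk a b m -> walk a b m' -> walk u v (s1 ++ m ++ s2) ->
  walk u v (s1 ++ m' ++ s2).
Proof.
case/walkP=> p [-> Hp Hl] /walkP[p' [-> Hp' Hl']].
case: s1 => [|x s1] /=; rewrite !cat_path !last_cat /=.
  by rewrite Hl Hl' Hp Hp'.
by rewrite !cat_path !last_cat Hl Hl' Hp Hp'.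
Qed.

Lemma walk_segment u v s1 x p s2 :
  walk u v (s1 ++ (x :: p) ++ s2) -> walk x (last x p) (x :: p).
Proof.
case: s1 => [|y s1] /and3P[_ H _]; rewrite /= !eqxx andbT /=.
  by move: H; rewrite cat_path => /andP[].
by move: H; rewrite cat_path /= cat_path => /and4P[].
Qed.

Lemma walk_before u v s1 x s2 :
  walk u v (s1 ++ x :: s2) -> x != u ->
  exists s t, s1 = rcons s t /\ adj t x.
Proof.
case/lastP: s1 => [/walk_cons-> /eqP//|s t H _]; exists s, t; split=> //.
rewrite -cats1 -catA in H.
by case/and3P: (@walk_segment u v s t [:: x] s2 H) => _ /andP[].
Qed.

Lemma walk_after u v s1 x s2 :
  walk u v (s1 ++ x :: s2) -> x != v ->
  exists t s, s2 = t :: s /\ adj x t.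
Proof.
case: s2 => [|t s] H.
  by rewrite cats1 in H; rewrite (walk_last H) eqxx.
move=> _; exists t, s; split=> //.
by case/and3P: (@walk_segment u v s1 x [:: t] s H) => _ /andP[].
Qed.

Lemma geodesic_rev u v s : geodesic u v s -> geodesic v u (rev s).
Proof.
case=> Hw Hm; split=> [|s' Hs']; first exact: walk_rev.
by rewrite size_rev -(size_rev s'); apply/Hm/walk_rev.
Qed.

Lemma geodesic_segment u v s1 x p s2 :
  geodesic u v (s1 ++ (x :: p) ++ s2) -> geodesic x (last x p) (x :: p).
Proof.
case=> Hw Hm; have Hx := walk_segment Hw; split=> // m' Hm'.
by have := Hm _ (walk_subst Hx Hm' Hw); rewrite !size_cat; lia.
Qed.

Lemma geodesic_subst u v a b s1 m m' s2 :
  geodesic u v (s1 ++ m ++ s2) -> walk a b m -> walk a b m' ->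
  size m' = size m -> geodesic u v (s1 ++ m' ++ s2).
Proof.
case=> Hw Hm Hab Hab' Hs; split=> [|s' /Hm]; first exact: (walk_subst Hab Hab' Hw).
by rewrite !size_cat Hs.
Qed.

Lemma geodesic_uniq u v s : geodesic u v s -> uniq s.
Proof.
case=> /walkP[p [-> Hp Hl]] Hm.
case: (shortenP Hp) => p' Hp' Up' sub_p' /= in Hl *.
have Hs : size (u :: p) <= size (u :: p').
  by apply: Hm; apply/walkP; exists p'.
apply: leq_size_uniq Up' _ Hs => x.
by rewrite !inE => /orP[->//|/sub_p' ->]; rewrite orbT.
Qed.

Lemma geodesic_exists u v s : walk u v s -> exists s', geodesic u v s'.
Proof.
move=> Hs.
have ex : exists k, [exists t : k.-tuple G, walk u v t].
  by exists (size s); apply/existsP; exists (in_tuple s).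
case: (ex_minnP ex) => k /existsP[t Ht] Hk; exists t; split=> // s' Hs'.
by rewrite size_tuple; apply/Hk/existsP; exists (in_tuple s').
Qed.

Lemma edge_onP x y s :
  reflect (exists s1 s2, s = s1 ++ [:: x; y] ++ s2 \/ rev s = s1 ++ [:: x; y] ++ s2)
          (edge_on x y s).
Proof.
have revxy : rev [:: x; y] = [:: y; x] by [].
apply: (iffP orP) => [[]|[s1 [s2 []]] E].
- by case/infixP=> s1 [s2 ->]; exists s1, s2; left.
- by rewrite -revxy infix_revLR => /infixP[s1 [s2 E]]; exists s1, s2; right.
- by left; apply/infixP; exists s1, s2.
by right; rewrite -revxy infix_revLR; apply/infixP; exists s1, s2.
Qed.

Lemma edge_on_cat x y s1 s2 : edge_on x y (s1 ++ [:: x; y] ++ s2).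
Proof. by apply/edge_onP; exists s1, s2; left. Qed.

Lemma edge_onC x y s : edge_on x y s = edge_on y x s.
Proof. exact: orbC. Qed.

Lemma edge_on_rev x y s : edge_on x y (rev s) = edge_on x y s.
Proof.
by rewrite /edge_on -!infix_revLR orbC.
Qed.

Lemma edge_on_mem x y s : edge_on x y s -> x \in s.
Proof.
case/edge_onP=> s1 [s2 [->|E]]; first by rewrite mem_cat !inE eqxx orbT.
by rewrite -mem_rev E mem_cat !inE eqxx orbT.
Qed.

End Geodesics.

(** * Covering and monitoring edges *)

Section Covering.
Variable G : sgraph.
Implicit Types (u v w x y : G) (s : seq G) (S : {set G}).

Definition monitored S x y := exists u v,
  [/\ u \in S, v \in S, u != v & forall s, geodesic u v s -> edge_on x y s].

Lemma monitoredC S x y : monitored S x y -> monitored S y x.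
Proof.
by case=> u [v [uS vS Duv H]]; exists u, v; split=> // s; rewrite edge_onC; apply: H.
Qed.

Lemma geodesic_orient S u v s x y :
  u \in S -> v \in S -> geodesic u v s -> edge_on x y s ->
  exists u' v' s1 s2, [/\ u' \in S, v' \in S & geodesic u' v' (s1 ++ [:: x; y] ++ s2)].
Proof.
move=> uS vS Hs /edge_onP[s1 [s2 [E|E]]].
  by exists u, v, s1, s2; rewrite -E.
by exists v, u, s1, s2; rewrite -E; split=> //; apply: geodesic_rev.
Qed.

Lemma strong_edge_geodetic S : strong_edge_geodetic_set S -> edge_geodetic_set S.
Proof.
case=> P [HP cov] x y /cov[u [v [uS vS Duv Hxy]]].
by exists u, v, (P u v); split=> //; have [] := HP u v uS vS Duv.
Qed.

Lemma edge_geodetic_geodetic S :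
  (forall x, exists y, adj x y) -> edge_geodetic_set S -> geodetic_set S.
Proof.
move=> nbr cov x; have [y /cov[u [v [s [uS vS Duv Hs Hxy]]]]] := nbr x.
by exists u, v, s; split=> //; apply: edge_on_mem Hxy.
Qed.

Lemma leaf_in_geodetic S w v :
  geodetic_set S -> (forall t, adj w t -> t = v) -> w \in S.
Proof.
move=> cov leaf; have [a [b [s [aS bS _ Hs ws]]]] := cov w.
case/splitPr: ws Hs => s1 s2 Hs.
have [->//|Dwa] := eqVneq w a; have [->//|Dwb] := eqVneq w b.
have [s' [t [E /[1!adj_sym]/leaf Et]]] := walk_before Hs.1 Dwa.
have [t' [s'' [E' /leaf Et']]] := walk_after Hs.1 Dwb.
have := geodesic_uniq Hs; rewrite E E' Et Et' cat_uniq => /and3P[_ /hasP[]].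
by exists v; rewrite ?mem_rcons !inE eqxx ?orbT.
Qed.

(** A geodesic through the edge vw cannot go on beyond w: the next vertex
    would be v or adjacent to v. *)
Lemma enclosed_in_edge_geodetic S v w :
  edge_geodetic_set S -> adj v w ->
  (forall t, adj w t -> t = v \/ adj v t) -> w \in S.
Proof.
move=> cov vw enc; have [a [b [s [aS bS _ Hs Hvw]]]] := cov v w vw.
have [a' [b' [s1 [s2 [_ bS' H]]]]] := geodesic_orient aS bS Hs Hvw.
have [->//|Dwb] := eqVneq w b'.
have H1 : walk a' b' ((s1 ++ [:: v]) ++ w :: s2) by rewrite -catA; case: H.
have [t [s3 [E /enc Ht]]] := walk_after H1 Dwb; rewrite E in H.
have [_ Hm] := @geodesic_segment _ _ _ s1 v [:: w; t] s3 H.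
case: Ht => [Ev|vt].
  by have := Hm [:: v]; rewrite /= Ev !eqxx => /(_ isT).
by have := Hm [:: v; t]; rewrite /= vt !eqxx => /(_ isT).
Qed.

Hypothesis geod : forall u v, exists s, geodesic u v s.

Lemma meg_edge_geodetic S : meg_set S -> edge_geodetic_set S.
Proof.
move=> cov x y /cov[u [v [uS vS Duv Hxy]]]; have [s Hs] := geod u v.
by exists u, v, s; split=> //; apply: Hxy.
Qed.

(** Only the paths that start at r have to be chosen with care. An edge that
    some pair of S monitors is covered whatever geodesic that pair gets. *)
Lemma strong_of_star S r (F : G -> seq G) :
  r \in S -> (forall v, v \in S -> v != r -> geodesic r v (F v)) ->
  (forall x y, adj x y ->
     (exists2 v, (v \in S) && (v != r) & edge_on x y (F v)) \/ monitored S x y) ->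
  strong_edge_geodetic_set S.
Proof.
move=> rS HF cov.
have [g Hg] := fin_all_exists (fun uv : G * G => geod uv.1 uv.2).
pose P u v := if u == r then F v else if v == r then rev (F u) else
  if enum_rank u < enum_rank v then g (u, v) else rev (g (v, u)).
have HP u v : u \in S -> v \in S -> u != v -> geodesic u v (P u v) /\ P v u = rev (P u v).
  move=> uS vS Duv; rewrite /P.
  have [Eu|Du] := eqVneq u r; have [Ev|Dv] := eqVneq v r.
  - by rewrite Eu Ev eqxx in Duv.
  - by rewrite Eu; split=> //; apply: HF.
  - by rewrite revK Ev; split=> //; apply/geodesic_rev/HF.
  have Dr : (enum_rank u : nat) != enum_rank v.
    by apply: contra Duv => /eqP/val_inj/enum_rank_inj ->.
  case: ltngtP Dr => // H _; first by split; [exact: (Hg (u, v))|].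
  by rewrite revK; split=> //; apply/geodesic_rev/(Hg (v, u)).
exists P; split=> // x y /cov[[v /andP[vS Dv] Hv]|[u [v [uS vS Duv H]]]].
  by exists r, v; split=> //; [rewrite eq_sym | rewrite /P eqxx].
by exists u, v; split=> //; apply: H; case: (HP u v).
Qed.

End Covering.

(** * Level functions and climbing walks *)

Section Levels.
Variables (G : sgraph) (lev : G -> nat).
Hypothesis lev_adj : forall x y : G, adj x y -> lev y <= (lev x).+1.
Implicit Types (u v w x y d : G) (s p : seq G).

Definition asc : rel G := fun x y => adj x y && (lev y == (lev x).+1).

Definition ascending u v s := exists p, [/\ s = u :: p, path asc u p & last u p = v].

Definition below u v := exists s, ascending u v s.

(** When u is below v the geodesics from u to v are ascending walks, so a
    bottleneck is an edge that the pair monitors. *)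
Definition bottleneck u v x y := forall s, ascending u v s -> edge_on x y s.

Lemma asc_adj x y : asc x y -> adj x y. Proof. by case/andP. Qed.

Lemma lev_path u p : path (@adj G) u p -> lev (last u p) <= lev u + size p.
Proof.
elim: p u => [|y p IH] u /=; first by rewrite addn0.
by case/andP=> /lev_adj uy /IH; lia.
Qed.

Lemma lev_asc u p : path asc u p -> lev (last u p) = lev u + size p.
Proof.
elim: p u => [|y p IH] u /=; first by rewrite addn0.
by case/andP=> /andP[_ /eqP uy] /IH; lia.
Qed.

Lemma tight_asc u p :
  path (@adj G) u p -> lev (last u p) = lev u + size p -> path asc u p.
Proof.
elim: p u => //= y p IH u /andP[uy Hp] E.
have Hy := lev_adj uy; have Hl := lev_path Hp.
rewrite IH // /asc ?uy /=; lia.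
Qed.

Lemma ascending_geodesic u v s : ascending u v s -> geodesic u v s.
Proof.
case=> p [-> Hp Hl]; split.
  by apply/walkP; exists p; split=> //; apply: sub_path Hp => ? ? /asc_adj.
move=> s' /walkP[p' [-> /lev_path Hp' Hl']] /=.
by have := lev_asc Hp; rewrite Hl -Hl'; lia.
Qed.

(** The levels rise by at most one per step, so a walk as short as the
    difference of levels has to rise at every step. *)
Lemma geodesic_ascending u v s : below u v -> geodesic u v s -> ascending u v s.
Proof.
case=> s0 H0 [/walkP[p [-> Hp Hl]] Hm]; exists p; split=> //.
have [p0 [E0 Hp0 Hl0]] := H0; apply: tight_asc => //.
have := Hm s0 (proj1 (ascending_geodesic H0)); rewrite E0 /=.
have := lev_asc Hp0; rewrite Hl0; have := lev_path Hp; rewrite Hl; lia.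
Qed.

Lemma below_refl u : below u u. Proof. by exists [:: u], [::]. Qed.

Lemma below_asc u v : asc u v -> below u v.
Proof. by move=> uv; exists [:: u; v], [:: v]; rewrite /= uv. Qed.

Lemma ascending_cat u v w s p :
  ascending u v s -> ascending v w (v :: p) -> ascending u w (s ++ p).
Proof.
case=> p1 [-> Hp1 Hl] [p2 [[<-] Hp2 Hw]].
by exists (p1 ++ p); rewrite cat_path last_cat Hl Hp1.
Qed.

Lemma below_trans v u w : below u v -> below v w -> below u w.
Proof.
case=> s Hs [s' Hs']; have [p [E _ _]] := Hs'; rewrite E in Hs'.
by exists (s ++ p); apply: ascending_cat Hs'.
Qed.

Lemma ascending_last u v s d :
  (forall t, asc t v -> t = d) -> u != v -> ascending u v s ->
  exists2 s', s = rcons s' v & ascending u d s'.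
Proof.
move=> Hd Duv [p [-> Hp Hl]]; case/lastP: p Hp Hl => [|p t] /=.
  by move=> _ Euv; rewrite Euv eqxx in Duv.
rewrite last_rcons rcons_path => /andP[Hp Ht] Et; rewrite Et in Ht *.
by exists (u :: p) => //; exists p; split=> //; apply: Hd.
Qed.

Lemma ascending_first u v s d :
  (forall t, asc u t -> t = d) -> u != v -> ascending u v s ->
  exists2 s', s = u :: s' & ascending d v s'.
Proof.
move=> Hd Duv [[|t p] [-> /= Hp Hl]]; first by rewrite Hl eqxx in Duv.
case/andP: Hp => /Hd Et Hp; rewrite Et in Hp Hl *.
by exists (d :: p) => //; exists p.
Qed.

Lemma bottleneck_last u v d :
  (forall t, asc t v -> t = d) -> u != v -> bottleneck u v d v.
Proof.
move=> Hd Duv s /(ascending_last Hd Duv)[s' -> [p [-> _ <-]]].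
by rewrite lastI -!cats1 -catA; apply: (edge_on_cat _ _ _ [::]).
Qed.

Lemma bottleneck_first u v d :
  (forall t, asc u t -> t = d) -> u != v -> bottleneck u v u d.
Proof.
move=> Hd Duv s /(ascending_first Hd Duv)[s' -> [p [-> _ _]]].
exact: (edge_on_cat u d [::] p).
Qed.

Lemma edge_on_sub x y (s1 m s2 : seq G) : edge_on x y m -> edge_on x y (s1 ++ m ++ s2).
Proof.
case/edge_onP=> t1 [t2 [->|E]].
  by rewrite -!catA catA; apply: edge_on_cat.
rewrite -edge_on_rev !rev_cat E -!catA.
by rewrite catA; apply: edge_on_cat.
Qed.

Lemma bottleneck_prev u v d x y :
  (forall t, asc t v -> t = d) -> u != v -> bottleneck u d x y -> bottleneck u v x y.
Proof.
move=> Hd Duv H s /(ascending_last Hd Duv)[s' -> /H /(edge_on_sub [::] [:: v])].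
by rewrite cats1.
Qed.

Lemma bottleneck_next u v d x y :
  (forall t, asc u t -> t = d) -> u != v -> bottleneck d v x y -> bottleneck u v x y.
Proof.
move=> Hd Duv H s /(ascending_first Hd Duv)[s' -> /H /(edge_on_sub [:: u] [::])].
by rewrite cats0.
Qed.

Lemma monitored_bottleneck (S : {set G}) u v x y :
  u \in S -> v \in S -> lev u != lev v -> below u v -> bottleneck u v x y ->
  monitored S x y.
Proof.
move=> uS vS Dl uv H; exists u, v; split=> //; first by apply: contraNneq Dl => ->.
by move=> s /(geodesic_ascending uv)/H.
Qed.

End Levels.

(** * The graph *)

Inductive label :=
| Tail
| Hub of nat
| Near of nat & nat
| Far of nat & nat
| Leaf of nat
| Chord of nat.

Definition encode_label (l : label) : nat * nat * nat :=
  match l with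
  | Tail => (0, 0, 0)
  | Hub i => (1, i, 0)
  | Near i j => (2, i, j)
  | Far i j => (3, i, j)
  | Leaf m => (4, m, 0)
  | Chord m => (5, m, 0)
  end.

Definition decode_label (c : nat * nat * nat) : label :=
  match c with
  | (0, _, _) => Tail
  | (1, i, _) => Hub i
  | (2, i, j) => Near i j
  | (3, i, j) => Far i j
  | (4, m, _) => Leaf m
  | (_, m, _) => Chord m
  end.

Lemma encode_labelK : cancel encode_label decode_label.
Proof. by case. Qed.

HB.instance Definition _ := Equality.copy label (can_type encode_labelK).

(** Each edge is listed in one direction, towards the higher level; only the
    edges from Far f 0 to the chords stay on one level. *)
Definition link (f : nat) (l l' : label) : bool :=
  match l, l' with
  | Tail, Hub i => i == 0
  | Hub i, Near i' _ => i == i'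
  | Near i j, Far i' j' => (i == i') && (j == j')
  | Far i _, Hub i' => i.+1 == i'
  | Near i j, Chord _ | Far i j, Leaf _ | Far i j, Chord _ => (i == f) && (j == 0)
  | Chord _, Hub i => i == f.+1
  | _, _ => false
  end.

(** The distance to the tail, as if there always were one. *)
Definition level (f : nat) (l : label) : nat :=
  match l with
  | Tail => 0
  | Hub i => (3 * i).+1
  | Near i _ => (3 * i).+2
  | Far i _ => (3 * i).+3
  | Leaf _ => (3 * f).+4
  | Chord _ => (3 * f).+3
  end.

Definition valid (f n q k : nat) (pend : bool) (l : label) : bool :=
  match l with
  | Tail => pend
  | Hub i => i <= f.+1
  | Near i j | Far i j => [&& i <= f, j < n & (i == f) || (j < 2)]
  | Leaf m => m < q
  | Chord m => m < k
  end.

(** Vertices are handled through their labels, so that nothing below depends on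
    how the program numbers them. *)
Record network (f n q k : nat) (pend : bool) (G : sgraph) := Network {
  lab : G -> label;
  vtx : label -> G;
  lab_valid : forall x, valid f n q k pend (lab x);
  labK : cancel lab vtx;
  vtxK : forall l, valid f n q k pend l -> lab (vtx l) = l;
  adj_lab : forall x y, adj x y = link f (lab x) (lab y) || link f (lab y) (lab x)
}.

Ltac label_arith :=
  intros; simpl in *;
  first [ by exfalso; lia | by f_equal; lia | lia | idtac ].

Ltac label_cases := move=> [|?|? ?|? ?|?|?]; label_arith.

Section Network.
Variables (f n q k : nat) (pend : bool) (G : sgraph).
Hypotheses (n_gt1 : 1 < n) (q_gt0 : 0 < q) (root_low : pend || (0 < f)).
Variable N : network f n q k pend G.

Local Notation ok := (valid f n q k pend).
Local Notation lbl := (lab N).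
Local Notation vx := (vtx N).
Local Notation lvl := (level f).
Implicit Types (l d : label) (u v x y : G) (S : {set G}).

Definition lev x := lvl (lbl x).

Lemma lev_vtx l : ok l -> lev (vx l) = lvl l.
Proof. by move=> Hl; rewrite /lev (vtxK N). Qed.

Lemma adj_vtx l l' : ok l -> ok l' -> adj (vx l) (vx l') = link f l l' || link f l' l.
Proof. by move=> Hl Hl'; rewrite (adj_lab N) !(vtxK N). Qed.

Lemma vtx_inj l l' : ok l -> ok l' -> vx l = vx l' -> l = l'.
Proof. by move=> Hl Hl' E; rewrite -(vtxK N Hl) E (vtxK N). Qed.

Lemma vtx_neq l l' : ok l -> ok l' -> l != l' -> vx l != vx l'.
Proof. by move=> Hl Hl'; apply: contraNneq => /vtx_inj ->. Qed.

Lemma link_level l l' : link f l l' -> lvl l' <= (lvl l).+1 /\ lvl l <= lvl l'.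
Proof. by case: l => [|?|? ?|? ?|?|?]; case: l' => [|?|? ?|? ?|?|?]; label_arith. Qed.

Lemma lev_adj x y : adj x y -> lev y <= (lev x).+1.
Proof. by rewrite (adj_lab N) /lev => /orP[] /link_level; lia. Qed.

Lemma neighbour l t : ok l -> adj (vx l) t ->
  exists d, [/\ ok d, link f l d || link f d l & t = vx d].
Proof.
move=> Hl; rewrite (adj_lab N) (vtxK N) // => Ht.
by exists (lbl t); split; rewrite ?labK //; apply: lab_valid.
Qed.

Lemma asc_vtx l l' : ok l -> ok l' -> link f l l' -> lvl l' = (lvl l).+1 ->
  asc lev (vx l) (vx l').
Proof. by move=> Hl Hl' H E; rewrite /asc adj_vtx // !lev_vtx // E H eqxx. Qed.

Lemma sole_pred l d : ok l ->
  (forall l', ok l' -> link f l' l -> lvl l = (lvl l').+1 -> l' = d) ->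
  forall t, asc lev t (vx l) -> t = vx d.
Proof.
move=> Hl H t /andP[]; rewrite (adj_lab N) (vtxK N) // lev_vtx // => Ht /eqP E.
rewrite -(labK N t) (H (lbl t)) ?lab_valid //.
by case/orP: Ht => // /link_level; rewrite E /lev; lia.
Qed.

Lemma sole_succ l d : ok l ->
  (forall l', ok l' -> link f l l' -> lvl l' = (lvl l).+1 -> l' = d) ->
  forall t, asc lev (vx l) t -> t = vx d.
Proof.
move=> Hl H t /andP[]; rewrite (adj_lab N) (vtxK N) // lev_vtx // => Ht /eqP E.
rewrite -(labK N t) (H (lbl t)) ?lab_valid //.
by case/orP: Ht => // /link_level; rewrite -/(lev t) E; lia.
Qed.

Definition root := if pend then Tail else Hub 0.

Lemma rootP : pend /\ root = Tail \/ ~~ pend /\ root = Hub 0.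
Proof. by rewrite /root; case: (pend); [left | right]. Qed.

Lemma root_ok : ok root. Proof. by case: rootP => [[? ->]|[_ ->]]. Qed.

Lemma root_level : lvl root <= 3 * f.
Proof. by case: rootP => [[_ ->]|[? ->]] //=; move: root_low; lia. Qed.

Lemma below_link l l' : ok l -> ok l' -> link f l l' -> lvl l' = (lvl l).+1 ->
  below lev (vx l) (vx l').
Proof. by move=> Hl Hl' H E; apply/below_asc/asc_vtx. Qed.

Lemma below_hub i c : i + c <= f.+1 -> below lev (vx (Hub i)) (vx (Hub (i + c))).
Proof.
elim: c => [|c IH] H; first by rewrite addn0; apply: below_refl.
apply: below_trans (IH _) _; first lia.
apply: (below_trans (v := vx (Near (i + c) 0))).
  by apply: below_link; label_arith.
apply: (below_trans (v := vx (Far (i + c) 0))); apply: below_link; label_arith.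
Qed.

Lemma root_below_hub i : i <= f.+1 -> below lev (vx root) (vx (Hub i)).
Proof.
move=> H; have H0 := @below_hub 0 i H; case: rootP => [[Hp ->]|[_ ->]] //.
by apply: below_trans H0; apply: below_link.
Qed.

Lemma root_below x : below lev (vx root) x.
Proof.
rewrite -(labK N x); case: (lbl x) (lab_valid N x) => [|i|i j|i j|m|m] /= H.
- by case: rootP H => [[_ ->] _|[/negP]] //; apply: below_refl.
- exact: root_below_hub.
- apply: below_trans (root_below_hub (i := i) _) _; first lia.
  by apply: below_link; label_arith.
- apply: below_trans (root_below_hub (i := i) _) _; first lia.
  apply: (below_trans (v := vx (Near i j))); apply: below_link; label_arith.
- apply: below_trans (root_below_hub (i := f) _) _; first lia.
  apply: (below_trans (v := vx (Near f 0))); first by apply: below_link; label_arith.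
  by apply: (below_trans (v := vx (Far f 0))); apply: below_link; label_arith.
apply: below_trans (root_below_hub (i := f) _) _; first lia.
by apply: (below_trans (v := vx (Near f 0))); apply: below_link; label_arith.
Qed.

Lemma below_last l : ok l -> (forall m, l <> Leaf m) ->
  below lev (vx l) (vx (Hub f.+1)).
Proof.
have H0 i : i <= f.+1 -> below lev (vx (Hub i)) (vx (Hub f.+1)).
  by move=> H; have := @below_hub i (f.+1 - i); rewrite subnKC //; apply.
case: l => [|i|i j|i j|m|m] Hl Dl.
- by apply: below_trans (H0 0 _) => //; apply: below_link.
- exact: H0.
- apply: below_trans (H0 i.+1 _); last by label_arith.
  by apply: (below_trans (v := vx (Far i j))); apply: below_link; label_arith.
- by apply: below_trans (H0 i.+1 _); [apply: below_link; label_arith | label_arith].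
- by case: (Dl m).
by apply: below_link; label_arith.
Qed.

Lemma geod u v : exists s, geodesic u v s.
Proof.
have [s /ascending_geodesic] := root_below u; case=> [|/walk_rev Hs _]; first exact: lev_adj.
have [s' H'] := root_below v; have [p [Es' _ _]] := H'; rewrite Es' in H'.
case: (ascending_geodesic lev_adj H') => {H'} H' _.
exact: geodesic_exists (walk_cat Hs H').
Qed.

Lemma network_connected : connected G.
Proof.
split; first by apply/card_gt0P; exists (vx root).
move=> x y; have [s [/walkP[p [_ Hp Hl]] _]] := geod x y.
by apply/connectP; exists p.
Qed.

Definition vset (t : seq label) : {set G} := [set x | lbl x \in t].

Lemma in_vset t l : ok l -> (vx l \in vset t) = (l \in t).
Proof. by move=> Hl; rewrite inE (vtxK N). Qed.

Lemma card_vset t : uniq t -> all ok t -> #|vset t| = size t.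
Proof.
move=> Ut /allP Ht; rewrite -(size_map vx).
have Ut' : uniq (map vx t) by rewrite map_inj_in_uniq // => l l' /Ht ? /Ht ?; apply: vtx_inj.
rewrite -(card_uniqP Ut'); apply: eq_card => x; rewrite inE.
apply/idP/mapP => [Hx|[l Hl ->]]; last by rewrite (vtxK N) ?Ht.
by exists (lbl x); rewrite ?labK.
Qed.


(** * The four vertex sets *)

Lemma through u v x : below lev u x -> below lev x v ->
  exists2 s, geodesic u v s & x \in s.
Proof.
case=> s Hs [s' Hs']; have [p [E Hp Hl]] := Hs'; rewrite E in Hs'.
exists (s ++ p); first exact: (ascending_geodesic lev_adj (ascending_cat Hs Hs')).
by case: Hs => p' [-> _ <-]; rewrite mem_cat mem_last.
Qed.

Lemma through_edge u v x y : below lev u x -> asc lev x y -> below lev y v ->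
  exists2 s, geodesic u v s & edge_on x y s.
Proof.
case=> s Hs xy [s' Hs']; have [p [E Hp Hl]] := Hs'; rewrite E in Hs'.
have Hxy : ascending lev x y (x :: [:: y]) by exists [:: y]; rewrite /= xy.
have := ascending_cat (ascending_cat Hs Hxy) Hs'; case: Hs => p' [-> _ <-] H.
exists (((u :: p') ++ [:: y]) ++ p); first exact: (ascending_geodesic lev_adj H).
by rewrite lastI -cats1 -!catA; apply: (edge_on_cat _ _ _ p).
Qed.

Lemma geodesic_two u m v : adj u m -> adj m v -> u != v -> ~~ adj u v ->
  geodesic u v [:: u; m; v].
Proof.
move=> um mv Duv Huv; split=> [|s' /walkP[[|y [|z p]] [-> Hp Hl]] //].
- by rewrite /= um mv !eqxx.
- by move: Duv; rewrite -Hl eqxx.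
by move: Hp Huv; rewrite -Hl /= => /andP[->].
Qed.

Lemma monitored_middle S u m v :
  u \in S -> v \in S -> u != v -> ~~ adj u v -> adj u m -> adj m v ->
  (forall t, adj u t -> adj t v -> t = m) -> monitored S u m /\ monitored S m v.
Proof.
move=> uS vS Duv Huv um mv Hm.
suff H s : geodesic u v s -> s = [:: u; m; v].
  by split; exists u, v; split=> // s /H->;
    [exact: (edge_on_cat u m [::] [:: v]) | exact: (edge_on_cat m v [:: u] [::])].
case=> /walkP[p [-> Hp Hl]] /(_ _ (proj1 (geodesic_two um mv Duv Huv))).
case: p Hp Hl => [|t [|z [|? ?]]] //=.
- by move=> _ E; rewrite E eqxx in Duv.
- by rewrite andbT => Ht E; rewrite -E Ht in Huv.
by rewrite andbT => /andP[ut tz] E _; rewrite -E in Hm *; rewrite (Hm t).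
Qed.

Definition leaves := [seq Leaf m | m <- iota 0 q].
Definition chords := [seq Chord m | m <- iota 0 k].
Definition far_ends := [seq Far f j | j <- iota 1 n.-1].
Definition near_ends := [seq Near i j | i <- iota 0 f, j <- iota 0 2].

Definition geodetic_labels := [:: root, Hub f.+1 & leaves].
Definition edge_geodetic_labels := [:: root, Hub f.+1 & leaves ++ chords].
Definition strong_labels := root :: leaves ++ chords ++ far_ends.
(** The early stages are represented by their Near vertices, whose common
    neighbour is the hub below, so that both strands of the first stage are
    monitored even without a tail. *)
Definition meg_labels :=
  nseq pend Tail ++ near_ends ++ leaves ++ chords ++ far_ends.

Lemma mem_leaves l : (l \in leaves) = if l is Leaf m then m < q else false.
Proof.
apply/mapP/idP => [[m]|]; first by rewrite mem_iota => Hm ->.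
by case: l => // m Hm; exists m; rewrite ?mem_iota.
Qed.

Lemma mem_chords l : (l \in chords) = if l is Chord m then m < k else false.
Proof.
apply/mapP/idP => [[m]|]; first by rewrite mem_iota => Hm ->.
by case: l => // m Hm; exists m; rewrite ?mem_iota.
Qed.

Lemma mem_far_ends l :
  (l \in far_ends) = if l is Far i j then [&& i == f, 0 < j & j < n] else false.
Proof.
apply/mapP/idP => [[j]|]; first by rewrite mem_iota => Hj ->; lia.
by case: l => // i j /and3P[/eqP-> H0 H1]; exists j; rewrite // mem_iota; lia.
Qed.

Lemma mem_near_ends l :
  (l \in near_ends) = if l is Near i j then (i < f) && (j < 2) else false.
Proof.
apply/allpairsP/idP => [[[i j] /= [Hi Hj ->]]|].
  by move: Hi Hj; rewrite mem_iota !inE /=; lia.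
by case: l => // i j H; exists (i, j); rewrite /= mem_iota !inE; split=> //; lia.
Qed.

Lemma mem_pend l : (l \in nseq pend Tail) = if l is Tail then pend else false.
Proof. by rewrite mem_nseq; case: l; case: (pend). Qed.

Definition mem_labels :=
  (mem_leaves, mem_chords, mem_far_ends, mem_near_ends, mem_pend).

Lemma leaves_uniq : uniq leaves.
Proof. by rewrite map_inj_uniq ?iota_uniq // => ? ? []. Qed.
Lemma chords_uniq : uniq chords.
Proof. by rewrite map_inj_uniq ?iota_uniq // => ? ? []. Qed.
Lemma far_ends_uniq : uniq far_ends.
Proof. by rewrite map_inj_uniq ?iota_uniq // => ? ? []. Qed.
Lemma near_ends_uniq : uniq near_ends.
Proof. by rewrite allpairs_uniq ?iota_uniq // => [[? ?] [? ?]] _ _ /= [-> ->]. Qed.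

Lemma uniq_disjoint_cat (s t : seq label) :
  uniq s -> uniq t -> (forall l, l \in s -> l \notin t) -> uniq (s ++ t).
Proof.
move=> Us Ut H; rewrite cat_uniq Us Ut andbT; apply/hasPn => l Hl.
by apply: contraL Hl => /H.
Qed.

Lemma forced_labels_uniq : uniq (leaves ++ chords).
Proof.
apply: uniq_disjoint_cat leaves_uniq chords_uniq _ => l.
by rewrite !mem_labels; case: l.
Qed.

Lemma right_labels_uniq : uniq (leaves ++ chords ++ far_ends).
Proof.
rewrite catA; apply: uniq_disjoint_cat forced_labels_uniq far_ends_uniq _ => l.
by rewrite mem_cat !mem_labels; case: l.
Qed.

Lemma geodetic_labels_uniq : uniq geodetic_labels.
Proof.
rewrite /geodetic_labels cons_uniq inE cons_uniq !mem_labels leaves_uniq.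
by case: rootP => [[_ ->]|[_ ->]].
Qed.

Lemma edge_geodetic_labels_uniq : uniq edge_geodetic_labels.
Proof.
rewrite /edge_geodetic_labels cons_uniq inE cons_uniq !mem_cat !mem_labels.
by rewrite forced_labels_uniq; case: rootP => [[_ ->]|[_ ->]].
Qed.

Lemma strong_labels_uniq : uniq strong_labels.
Proof.
rewrite /strong_labels cons_uniq !mem_cat !mem_labels right_labels_uniq.
by case: rootP => [[_ ->]|[_ ->]].
Qed.

Lemma meg_labels_uniq : uniq meg_labels.
Proof.
apply: uniq_disjoint_cat => [||l]; first by case: (pend).
  apply: uniq_disjoint_cat near_ends_uniq right_labels_uniq _ => l.
  by rewrite !mem_cat !mem_labels; case: l => //= *; lia.
by rewrite !mem_cat !mem_labels; case: l.
Qed.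

Lemma geodetic_labels_ok : all ok geodetic_labels.
Proof.
rewrite /geodetic_labels /= root_ok leqnn /=; apply/allP => l.
by rewrite mem_labels; case: l.
Qed.

Lemma edge_geodetic_labels_ok : all ok edge_geodetic_labels.
Proof.
rewrite /edge_geodetic_labels /= root_ok leqnn /=; apply/allP => l.
by rewrite mem_cat !mem_labels; case: l => //= m; rewrite orbF.
Qed.

Lemma strong_labels_ok : all ok strong_labels.
Proof.
rewrite /strong_labels /= root_ok /=; apply/allP => l.
by rewrite !mem_cat !mem_labels; case: l => //= *; lia.
Qed.

Lemma meg_labels_ok : all ok meg_labels.
Proof.
apply/allP => l; rewrite !mem_cat !mem_labels.
by case: l => //= *; move: n_gt1; lia.
Qed.

Lemma size_geodetic_labels : size geodetic_labels = q + 2.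
Proof. by rewrite /= size_map size_iota addn2. Qed.

Lemma size_edge_geodetic_labels : size edge_geodetic_labels = q + k + 2.
Proof. by rewrite /= size_cat !size_map !size_iota addn2. Qed.

Lemma size_strong_labels : size strong_labels = q + k + n.
Proof. by rewrite /= !size_cat !size_map !size_iota; move: n_gt1; lia. Qed.

Lemma size_meg_labels : size meg_labels = pend + 2 * f + q + k + n.-1.
Proof.
rewrite !size_cat size_nseq size_allpairs !size_map !size_iota; lia.
Qed.

(** * Upper bounds *)

Lemma adj_ind (P : G -> G -> Prop) :
  (forall x y, P x y -> P y x) ->
  (forall l l', ok l -> ok l' -> link f l l' -> P (vx l) (vx l')) ->
  forall x y, adj x y -> P x y.
Proof.
move=> symP H x y; rewrite -(labK N x) -(labK N y) adj_vtx ?lab_valid //.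
by case/orP=> Hl; [|apply: symP]; apply: H Hl; apply: lab_valid.
Qed.

Lemma link_flat l l' : link f l l' ->
  lvl l' = (lvl l).+1 \/ exists m, l = Far f 0 /\ l' = Chord m.
Proof.
case: l => [|?|? ?|? ?|?|?]; case: l' => [|?|? ?|? ?|?|?] //= H; try by left; lia.
by right; case/andP: H => /eqP-> /eqP->; eexists.
Qed.

Lemma root_neq l : ok l -> 3 * f < lvl l -> vx root != vx l.
Proof.
move=> Hl H; apply: vtx_neq root_ok Hl _; apply: contraTneq H => <-.
by rewrite -leqNgt root_level.
Qed.

Lemma last_ok : ok (Hub f.+1). Proof. exact: leqnn. Qed.

Lemma leaf_ok : ok (Leaf 0). Proof. exact: q_gt0. Qed.

Lemma geodetic_upper : geodetic_set (vset geodetic_labels).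
Proof.
have rS : vx root \in vset geodetic_labels by rewrite in_vset ?root_ok // inE eqxx.
move=> x; rewrite -(labK N x); move: (lbl x) (lab_valid N x) => l Hl.
case El : (if l is Leaf _ then true else false).
  case: l El Hl => // m _ Hm.
  have [s Hs Hx] := through (root_below (vx (Leaf m))) (below_refl _ _).
  exists (vx root), (vx (Leaf m)), s; split=> //; last by apply: root_neq => //=; lia.
  by rewrite in_vset // !inE ?mem_cat mem_leaves (Hm : m < q) !orbT.
have not_leaf m : l <> Leaf m by move=> E; rewrite E in El.
have [s Hs Hx] := through (root_below (vx l)) (below_last Hl not_leaf).
exists (vx root), (vx (Hub f.+1)), s; split=> //.
  by rewrite in_vset ?last_ok // !inE eqxx orbT.
by apply: root_neq last_ok _ => /=; lia.
Qed.

Lemma edge_geodetic_upper : edge_geodetic_set (vset edge_geodetic_labels).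
Proof.
set S := vset _.
have rS : vx root \in S by rewrite in_vset ?root_ok // inE eqxx.
have lS m : m < q -> vx (Leaf m) \in S.
  by move=> Hm; rewrite in_vset // !inE mem_cat mem_leaves (Hm : m < q) !orbT.
apply: adj_ind => [x y [u [v [s [? ? ? ? Hs]]]]|l l' Hl Hl' H].
  by exists u, v, s; rewrite edge_onC.
case: (link_flat H) => [E|[m [El El']]]; last first.
  rewrite El El' in Hl Hl' *.
  exists (vx (Leaf 0)), (vx (Chord m)), [:: vx (Leaf 0); vx (Far f 0); vx (Chord m)].
  split; [exact: lS | | exact: vtx_neq | | exact: (edge_on_cat _ _ [:: _] [::])].
    by rewrite in_vset // !inE mem_cat mem_chords (Hl' : m < k) !orbT.
  by apply: geodesic_two; rewrite ?adj_vtx //=; [rewrite !eqxx | rewrite !eqxx | exact: vtx_neq].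
have Ha := asc_vtx Hl Hl' H E.
case El : (if l' is Leaf _ then true else false).
  case: l' El Hl' Ha {H E} => // m _ Hm Ha.
  have [s Hs Hx] := through_edge (root_below (vx l)) Ha (below_refl _ _).
  by exists (vx root), (vx (Leaf m)), s; split=> //; [apply: lS | apply: root_neq => //=; lia].
have not_leaf m : l' <> Leaf m by move=> E'; rewrite E' in El.
have [s Hs Hx] := through_edge (root_below (vx l)) Ha (below_last Hl' not_leaf).
exists (vx root), (vx (Hub f.+1)), s; split=> //.
  by rewrite in_vset ?last_ok // !inE eqxx orbT.
by apply: root_neq last_ok _ => /=; lia.
Qed.

Lemma last_between d j : 0 < j ->
  link f (Far f j) d || link f d (Far f j) ->
  link f d (Far f 0) || link f (Far f 0) d -> d = Hub f.+1.
Proof. by case: d => [|?|? ?|? ?|?|?] /=; label_arith. Qed.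

(** Predecessors in the last stage are unique except at the hub H_{f+1}, so the
    pairs of l0 with leaves, chords and far ends monitor every edge that avoids
    that hub and does not join Far f 0 to a chord. The remaining edges lie on
    the unique geodesics, of length two or three, that join a chord or a far end
    to a leaf, or a chord to a far end. *)
Lemma right_monitored S l0 :
  ok l0 -> lvl l0 <= (3 * f).+1 -> below lev (vx l0) (vx (Hub f)) -> vx l0 \in S ->
  (forall l, l \in leaves ++ chords ++ far_ends -> vx l \in S) ->
  forall l l', ok l -> ok l' -> link f l l' -> 3 * f < lvl l ->
  monitored S (vx l) (vx l').
Proof.
move=> H0 low0 b0 S0 SS.
have S_leaf m : m < q -> vx (Leaf m) \in S.
  by move=> ?; apply: SS; rewrite !mem_cat !mem_labels; lia.
have S_chord m : m < k -> vx (Chord m) \in S.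
  by move=> ?; apply: SS; rewrite !mem_cat !mem_labels; lia.
have S_far j : 0 < j < n -> vx (Far f j) \in S.
  by move=> ?; apply: SS; rewrite !mem_cat !mem_labels; lia.
have neq l : ok l -> (3 * f).+1 < lvl l -> vx l0 != vx l.
  by move=> Hl Hlt; apply: vtx_neq => //; apply: contraTneq Hlt => <-; rewrite -leqNgt.
have ok_near j : j < n -> ok (Near f j) by rewrite /=; lia.
have ok_far j : j < n -> ok (Far f j) by rewrite /=; lia.
have n0 : 0 < n by lia.
have b_near j : j < n -> below lev (vx l0) (vx (Near f j)).
  by move=> Hj; apply: below_trans b0 _; apply: below_link; label_arith.
have b_far j : j < n -> below lev (vx l0) (vx (Far f j)).
  by move=> Hj; apply: below_trans (b_near j Hj) _; apply: below_link; label_arith.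
have b_leaf m : m < q -> below lev (vx l0) (vx (Leaf m)).
  by move=> Hm; apply: below_trans (b_far 0 n0) _; apply: below_link; label_arith.
have b_chord m : m < k -> below lev (vx l0) (vx (Chord m)).
  by move=> Hm; apply: below_trans (b_near 0 n0) _; apply: below_link; label_arith.
have p_near j : j < n -> forall t, asc lev t (vx (Near f j)) -> t = vx (Hub f).
  by move=> Hj; apply: sole_pred; [exact: ok_near | label_cases].
have p_far j : j < n -> forall t, asc lev t (vx (Far f j)) -> t = vx (Near f j).
  by move=> Hj; apply: sole_pred; [exact: ok_far | label_cases].
have p_leaf m : m < q -> forall t, asc lev t (vx (Leaf m)) -> t = vx (Far f 0).
  by move=> Hm; apply: sole_pred; [exact: Hm | label_cases].
have p_chord m : m < k -> forall t, asc lev t (vx (Chord m)) -> t = vx (Near f 0).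
  by move=> Hm; apply: sole_pred; [exact: Hm | label_cases].
have mon (v : label) x y : ok v -> (3 * f).+1 < lvl v -> vx v \in S -> below lev (vx l0) (vx v) ->
    bottleneck lev (vx l0) (vx v) x y -> monitored S x y.
  move=> Hv Hlt Sv bv; apply: monitored_bottleneck => //; first exact: lev_adj.
  by rewrite !lev_vtx //; lia.
(* Strand 0 is continued to a leaf, as Far f 0 need not be in S. *)
have up_near j x y : j < n -> bottleneck lev (vx l0) (vx (Near f j)) x y -> monitored S x y.
  move=> Hj Hb.
  have Hb' : bottleneck lev (vx l0) (vx (Far f j)) x y.
    by apply: bottleneck_prev Hb; [exact: p_far | apply: neq; [exact: ok_far | rewrite /=; lia]].
  case: j Hj Hb Hb' => [|j] Hj Hb Hb'; last first.
    by apply: mon Hb'; [exact: ok_far | rewrite /=; lia | apply: S_far; lia | exact: b_far].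
  apply: (mon (Leaf 0)) => //=; [lia | exact: S_leaf | exact: b_leaf |].
  by apply: bottleneck_prev Hb'; [exact: p_leaf | apply: neq => //=; lia].
have up_far j : j < n -> monitored S (vx (Near f j)) (vx (Far f j)).
  move=> Hj; have Hb : bottleneck lev (vx l0) (vx (Far f j)) (vx (Near f j)) (vx (Far f j)).
    by apply: bottleneck_last; [exact: p_far | apply: neq; [exact: ok_far | rewrite /=; lia]].
  case: j Hj Hb => [|j] Hj Hb; last first.
    by apply: mon Hb; [exact: ok_far | rewrite /=; lia | apply: S_far; lia | exact: b_far].
  apply: (mon (Leaf 0)) => //=; [lia | exact: S_leaf | exact: b_leaf |].
  by apply: bottleneck_prev Hb; [exact: p_leaf | apply: neq => //=; lia].
have leaf_nbr m t : m < q -> adj t (vx (Leaf m)) -> t = vx (Far f 0).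
  rewrite adj_sym => Hm /(neighbour (l := Leaf m) Hm)[d [_ H ->]]; congr vx.
  by move: d H; label_cases.
have far_last j : 0 < j < n ->
    monitored S (vx (Far f j)) (vx (Hub f.+1)) /\ monitored S (vx (Far f 0)) (vx (Hub f.+1)).
  move=> Hj.
  have okH : ok (Hub f.+1) := leqnn _.
  have okF := ok_far j (proj2 (andP Hj)); have okF0 := ok_far 0 n0.
  suff Hs s : geodesic (vx (Far f j)) (vx (Leaf 0)) s ->
      s = [:: vx (Far f j); vx (Hub f.+1); vx (Far f 0); vx (Leaf 0)].
    split; [|apply: monitoredC]; exists (vx (Far f j)), (vx (Leaf 0)); split=> //;
      try exact: S_leaf; try exact: S_far; try exact: vtx_neq; move=> s /Hs ->.
      exact: (edge_on_cat _ _ [::] [:: _; _]).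
    exact: (edge_on_cat _ _ [:: _] [:: _]).
  have walk4 : walk (vx (Far f j)) (vx (Leaf 0))
      [:: vx (Far f j); vx (Hub f.+1); vx (Far f 0); vx (Leaf 0)].
    by rewrite /= !adj_vtx //= !eqxx ?orbT.
  have far_adj : ~~ adj (vx (Far f j)) (vx (Leaf 0)) /\ ~~ adj (vx (Far f j)) (vx (Far f 0)).
    by rewrite !adj_vtx //=; lia.
  case=> /walkP[p [-> Hp Hl]] /(_ _ walk4).
  case: p Hp Hl => [|t1 [|t2 [|t3 [|? ?]]]] //=.
  - by move=> _ /(vtx_inj okF leaf_ok).
  - by rewrite andbT => Ht E; move: far_adj.1; rewrite -E Ht.
  - case/and3P=> Ht1 Ht2 _ E; rewrite E in Ht2; move: far_adj.2.
    by rewrite -(leaf_nbr _ _ q_gt0 Ht2) Ht1.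
  case/and4P=> Ht1 Ht2 Ht3 _ E _; rewrite E in Ht3 *.
  have E2 := leaf_nbr _ _ q_gt0 Ht3; rewrite E2 in Ht2 *; congr [:: _; _; _; _].
  have [d [Hd H1 Ed]] := neighbour okF Ht1; rewrite Ed in Ht2 *; congr vx.
  rewrite (adj_vtx Hd okF0) in Ht2.
  by apply: last_between H1 Ht2; case/andP: Hj.
move=> l l' Hl Hl' H Hlt.
case: l Hl H Hlt => [|i|i j|i j|m|m]; case: l' Hl' => [|i'|i' j'|i' j'|m'|m'] //= Hl' Hl H Hlt.
- have [Ei Ei' Hj] : [/\ i = f, i' = f & j' < n] by split; lia.
  rewrite Ei Ei'; apply: (up_near j') => //.
  by apply: bottleneck_last; [exact: p_near | apply: neq; [exact: ok_near | rewrite /=; lia]].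
- have [Ei Ei' Ej Hj] : [/\ i = f, i' = f, j' = j & j < n] by split; lia.
  by rewrite Ei Ei' Ej; apply: up_far.
- have [-> ->] : i = f /\ j = 0 by lia.
  apply: (mon (Chord m')) => //=; [exact: S_chord | exact: b_chord |].
  by apply: bottleneck_last; [exact: p_chord | apply: neq => //=; lia].
- have [-> ->] : i = f /\ i' = f.+1 by lia.
  case: j Hl {H} => [|j] Hl; last by apply: (far_last j.+1 _).1; lia.
  by apply: (far_last 1 _).2; lia.
- have [-> ->] : i = f /\ j = 0 by lia.
  apply: (mon (Leaf m')) => //=; [lia | exact: S_leaf | exact: b_leaf |].
  by apply: bottleneck_last; [exact: p_leaf | apply: neq => //=; lia].
- have [-> ->] : i = f /\ j = 0 by lia.
  have okF0 := ok_far 0 n0; have okL := leaf_ok; have okC : ok (Chord m') := Hl'.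
  apply: monitoredC.
  apply: (proj1 (@monitored_middle _ (vx (Chord m')) _ (vx (Leaf 0)) _ _ _ _ _ _ _)).
  + exact: S_chord.
  + exact: S_leaf.
  + exact: vtx_neq.
  + by rewrite adj_vtx.
  + by rewrite adj_vtx //= !eqxx.
  + by rewrite adj_vtx //= !eqxx.
  by move=> t _; apply: leaf_nbr.
have -> : i' = f.+1 by lia.
have okC : ok (Chord m) := Hl; have okH : ok (Hub f.+1) := last_ok.
have okF := ok_far 1 n_gt1.
apply: (proj1 (@monitored_middle _ (vx (Chord m)) _ (vx (Far f 1)) _ _ _ _ _ _ _)).
- exact: S_chord.
- by apply: S_far; lia.
- exact: vtx_neq.
- by rewrite adj_vtx //= andbF.
- by rewrite adj_vtx //= !eqxx.
- by rewrite adj_vtx //= !eqxx.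
move=> t /(neighbour okC)[d [Hd H1 ->]]; rewrite adj_vtx // => H2; congr vx.
by move: d Hd H1 H2; label_cases.
Qed.

(** The tracks j = 0 and j = 1 together cover all the early stages; they extend
    to a leaf and to Far f 1 respectively. *)
Lemma track j : j < 2 -> exists s,
  [/\ ascending lev (vx root) (vx (Hub f)) s,
      pend -> edge_on (vx Tail) (vx (Hub 0)) s &
      forall i, i < f -> [/\ edge_on (vx (Hub i)) (vx (Near i j)) s,
        edge_on (vx (Near i j)) (vx (Far i j)) s &
        edge_on (vx (Far i j)) (vx (Hub i.+1)) s]].
Proof.
move=> Hj; suff H g : g <= f -> exists s,
    [/\ ascending lev (vx root) (vx (Hub g)) s,
      pend -> edge_on (vx Tail) (vx (Hub 0)) s &
      forall i, i < g -> [/\ edge_on (vx (Hub i)) (vx (Near i j)) s,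
        edge_on (vx (Near i j)) (vx (Far i j)) s &
        edge_on (vx (Far i j)) (vx (Hub i.+1)) s]] by exact: H.
elim: g => [|g IH] Hg.
  case: rootP => [[Hp ->]|[Hp ->]].
    exists [:: vx Tail; vx (Hub 0)]; split=> // [|_].
      by exists [:: vx (Hub 0)]; split=> //=; rewrite asc_vtx.
    exact: (edge_on_cat _ _ [::] [::]).
  by exists [:: vx (Hub 0)]; split=> // [|Hp']; [exists [::] | rewrite Hp' in Hp].
have [s [Hs Hp Hi]] := IH (ltnW Hg).
pose p := [:: vx (Near g j); vx (Far g j); vx (Hub g.+1)].
have Ha : ascending lev (vx (Hub g)) (vx (Hub g.+1)) (vx (Hub g) :: p).
  exists p; split=> //=; rewrite !asc_vtx //=; lia.
have ext x y : edge_on x y s -> edge_on x y (s ++ p) by apply: (edge_on_sub [::] p).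
exists (s ++ p); split=> [||i]; [exact: ascending_cat Ha | by move/Hp/ext |].
rewrite ltnS leq_eqVlt => /orP[/eqP->|/Hi[H1 H2 H3]]; last by split; apply: ext.
case: Hs => r [-> _ Hl]; rewrite lastI Hl cat_rcons /p.
set b := belast _ _; split.
- exact: (edge_on_cat _ _ b [:: _; _]).
- have := edge_on_cat (vx (Near g j)) (vx (Far g j)) (rcons b (vx (Hub g))) [:: vx (Hub g.+1)].
  by rewrite cat_rcons.
have := edge_on_cat (vx (Far g j)) (vx (Hub g.+1))
  (rcons (rcons b (vx (Hub g))) (vx (Near g j))) [::].
by rewrite !cat_rcons.
Qed.

Lemma left_link l l' : ok l -> ok l' -> link f l l' -> lvl l <= 3 * f ->
  [\/ l = Tail /\ l' = Hub 0 |
      exists i j, [/\ i < f, j < 2 & [\/ l = Hub i /\ l' = Near i j,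
         l = Near i j /\ l' = Far i j | l = Far i j /\ l' = Hub i.+1]]].
Proof.
case: l => [|i|i j|i j|m|m]; case: l' => [|i'|i' j'|i' j'|m'|m'] //= Hl Hl' H Hlt; try lia.
- by left; split=> //; f_equal; lia.
- by right; exists i, j'; split; [lia | lia | constructor 1]; split=> //; f_equal; lia.
- by right; exists i, j; split; [lia | lia | constructor 2]; split=> //; f_equal; lia.
by right; exists i, j; split; [lia | lia | constructor 3]; split=> //; f_equal; lia.
Qed.

Lemma last_strand_asc j : j < n ->
  asc lev (vx (Hub f)) (vx (Near f j)) && asc lev (vx (Near f j)) (vx (Far f j)).
Proof. by move=> Hj; rewrite !asc_vtx //=; lia. Qed.

Lemma leaf_asc : asc lev (vx (Far f 0)) (vx (Leaf 0)).
Proof. by rewrite asc_vtx //= ?eqxx //; lia. Qed.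

Lemma strong_upper : strong_edge_geodetic_set (vset strong_labels).
Proof.
set S := vset _.
have rS : vx root \in S by rewrite in_vset ?root_ok // inE eqxx.
have SS l : l \in leaves ++ chords ++ far_ends -> vx l \in S.
  move=> Hl; have Hl' : l \in strong_labels by rewrite inE Hl orbT.
  by rewrite in_vset // (allP strong_labels_ok).
have okL := leaf_ok; have okN j : j < 2 -> ok (Near f j) by rewrite /=; lia.
have okF j : j < 2 -> ok (Far f j) by rewrite /=; lia.
have LS : vx (Leaf 0) \in S by apply: SS; rewrite mem_cat mem_leaves q_gt0.
have FS : vx (Far f 1) \in S.
  by apply: SS; rewrite !mem_cat mem_far_ends eqxx n_gt1 !orbT.
have DL : vx (Leaf 0) != vx root by rewrite eq_sym; apply: root_neq => //=; lia.
have DF : vx (Far f 1) != vx root by rewrite eq_sym; apply: root_neq (okF 1 isT) _ => /=; lia.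
have DFL : vx (Far f 1) != vx (Leaf 0) by apply: vtx_neq okL _; first exact: okF.
have [s0 [H0 tail0 early0]] := track (isT : 0 < 2).
have [s1 [H1 _ early1]] := track (isT : 1 < 2).
have [g Hg] := fin_all_exists (geod (vx root)).
pose F0 := s0 ++ [:: vx (Near f 0); vx (Far f 0); vx (Leaf 0)].
pose F1 := s1 ++ [:: vx (Near f 1); vx (Far f 1)].
have HF0 : ascending lev (vx root) (vx (Leaf 0)) F0.
  apply: ascending_cat H0 _; exists [:: vx (Near f 0); vx (Far f 0); vx (Leaf 0)].
  by split=> //; case/andP: (last_strand_asc (ltnW n_gt1)) => /= -> ->; rewrite leaf_asc.
have HF1 : ascending lev (vx root) (vx (Far f 1)) F1.
  apply: ascending_cat H1 _; exists [:: vx (Near f 1); vx (Far f 1)].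
  by split=> //; case/andP: (last_strand_asc n_gt1) => /= -> ->.
pose F v := if v == vx (Leaf 0) then F0 else if v == vx (Far f 1) then F1 else g v.
have ext0 x y : edge_on x y s0 ->
    exists2 v, (v \in S) && (v != vx root) & edge_on x y (F v).
  move=> H; exists (vx (Leaf 0)); first by rewrite LS.
  by rewrite /F eqxx; apply: (edge_on_sub [::]).
have ext1 x y : edge_on x y s1 ->
    exists2 v, (v \in S) && (v != vx root) & edge_on x y (F v).
  move=> H; exists (vx (Far f 1)); first by rewrite FS.
  by rewrite /F (negPf DFL) eqxx; apply: (edge_on_sub [::]).
apply: (strong_of_star (F := F) geod rS) => [v vS Dv|].
  rewrite /F; case: eqP => [->|_]; first exact: (ascending_geodesic lev_adj HF0).
  by case: eqP => [->|_]; first exact: (ascending_geodesic lev_adj HF1).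
apply: adj_ind => [x y [[v vS Hv]|/monitoredC]|l l' Hl Hl' H]; [|by right|].
  by left; exists v; rewrite // edge_onC.
have [low|high] := leqP (lvl l) (3 * f); last first.
  right; apply: (right_monitored root_ok) high => //.
    exact: leqW root_level.
  exact: root_below_hub.
left; case: (left_link Hl Hl' H low) => [[El El']|[i [j [Hi Hj E]]]].
  by rewrite El in Hl *; rewrite El'; apply/ext0/tail0.
have [[a0 b0 c0] [a1 b1 c1]] := (early0 i Hi, early1 i Hi).
by case: j Hj E => [|[|//]] _ [[-> ->]|[-> ->]|[-> ->]];
  [exact: ext0|exact: ext0|exact: ext0|exact: ext1|exact: ext1|exact: ext1].
Qed.

Lemma meg_upper : meg_set (vset meg_labels).
Proof.
set S := vset _.
have SS l : l \in meg_labels -> vx l \in S.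
  by move=> Hl; rewrite in_vset // (allP meg_labels_ok).
have LS : vx (Leaf 0) \in S by apply: SS; rewrite !mem_cat mem_leaves q_gt0 !orbT.
have NS i j : i < f -> j < 2 -> vx (Near i j) \in S.
  by move=> Hi Hj; apply: SS; rewrite !mem_cat mem_near_ends Hi Hj !orbT.
have TS : pend -> vx Tail \in S by move=> Hp; apply: SS; rewrite mem_cat mem_pend Hp.
have ok_near i j : i < f -> j < 2 -> ok (Near i j) by rewrite /=; lia.
have ok_far i j : i < f -> j < 2 -> ok (Far i j) by rewrite /=; lia.
have ok_hub i : i < f -> ok (Hub i.+1) by rewrite /=; lia.
have below_leaf i : i <= f -> below lev (vx (Hub i)) (vx (Leaf 0)).
  move=> Hi; have := @below_hub i (f - i); rewrite subnKC // => /(_ (leqnSn f)) H0.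
  apply: (below_trans H0); apply: (below_trans (v := vx (Near f 0))).
    by apply: below_link; label_arith.
  by apply: (below_trans (v := vx (Far f 0))); apply: below_link; label_arith.
have below_near i j : i < f -> j < 2 -> below lev (vx (Near i j)) (vx (Hub i.+1)).
  by move=> Hi Hj; apply: (below_trans (v := vx (Far i j))); apply: below_link; label_arith.
have okL := leaf_ok.
have far_neq i j : i < f -> j < 2 -> vx (Far i j) != vx (Leaf 0).
  by move=> Hi Hj; apply: vtx_neq => //; apply: ok_far.
have near_neq i j : i < f -> j < 2 -> vx (Near i j) != vx (Leaf 0).
  by move=> Hi Hj; apply: vtx_neq => //; apply: ok_near.
apply: adj_ind => [x y /monitoredC //|l l' Hl Hl' H].
have [low|high] := leqP (lvl l) (3 * f).
  case: (left_link Hl Hl' H low) => [[El El']|[i [j [Hi Hj E]]]].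
    rewrite El El' in Hl *; apply: (monitored_bottleneck lev_adj (TS Hl) LS).
    - by rewrite !lev_vtx.
    - apply: below_trans (below_leaf 0 _) => //.
      by apply: below_link.
    apply: bottleneck_first; last exact: vtx_neq.
    by apply: sole_succ => //; label_cases.
  have s_near : forall t, asc lev (vx (Near i j)) t -> t = vx (Far i j).
    by apply: sole_succ; [exact: ok_near | label_cases].
  have s_far : forall t, asc lev (vx (Far i j)) t -> t = vx (Hub i.+1).
    by apply: sole_succ; [exact: ok_far | label_cases].
  have mon x y : bottleneck lev (vx (Near i j)) (vx (Leaf 0)) x y -> monitored S x y.
    apply: (monitored_bottleneck lev_adj (NS _ _ Hi Hj) LS).
      by rewrite (lev_vtx okL) (lev_vtx (ok_near i j Hi Hj)) /=; lia.
    by apply: below_trans (below_near i j Hi Hj) (below_leaf _ _).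
  case: E => [[-> ->]|[-> ->]|[-> ->]].
  - have ok0 := ok_near i 0 Hi isT; have ok1 := ok_near i 1 Hi isT.
    have okH : ok (Hub i) := leqW (ltnW Hi).
    have [||||||t|m0 m1] := @monitored_middle S (vx (Near i 0)) (vx (Hub i)) (vx (Near i 1)).
    + exact: NS.
    + exact: NS.
    + by apply: (vtx_neq ok0 ok1); apply/eqP => -[].
    + by rewrite (adj_vtx ok0 ok1).
    + by rewrite (adj_vtx ok0 okH) /= eqxx.
    + by rewrite (adj_vtx okH ok1) /= eqxx.
    + move=> /(neighbour ok0)[d [Hd H1 ->]]; rewrite adj_vtx // => H2; congr vx.
      by move: d Hd H1 H2; label_cases.
    by case: j Hj {s_near s_far mon} => [|[|//]] _ //; apply: monitoredC.
  - by apply: mon; apply: bottleneck_first s_near (near_neq _ _ Hi Hj).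
  apply: mon; apply: bottleneck_next s_near (near_neq _ _ Hi Hj) _.
  by apply: bottleneck_first s_far (far_neq _ _ Hi Hj).
have SR d : d \in leaves ++ chords ++ far_ends -> vx d \in S.
  move=> Hd; apply: SS; rewrite /meg_labels !(mem_cat d (_ : seq label)) in Hd *.
  by rewrite Hd !orbT.
case: rootP => [[Hp Er]|[Hp _]].
  apply: (right_monitored (l0 := Tail)) high => //; last exact: TS.
  by rewrite -Er; apply: root_below_hub.
have f_gt0 : 0 < f by move: root_low; rewrite (negPf Hp).
apply: (right_monitored (l0 := Near 0 0) _ _ _ _ SR Hl Hl' H high).
- by rewrite /=; lia.
- by rewrite /=; lia.
- apply: below_trans (below_near 0 0 f_gt0 isT) _.
  by have := @below_hub 1 f.-1; rewrite add1n prednK //; apply.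
exact: NS.
Qed.

(** * Lower bounds *)

Lemma card_keys (T : eqType) (key : G -> T) (t : seq T) S :
  uniq t -> (forall c, c \in t -> exists2 x, x \in S & key x = c) ->
  size t <= #|S|.
Proof.
move=> Ut H; rewrite cardE -(size_map key); apply: uniq_leq_size => // c /H[x xS <-].
by apply: map_f; rewrite mem_enum.
Qed.

Lemma has_neighbour x : exists y, adj x y.
Proof.
rewrite -(labK N x); case: (lbl x) (lab_valid N x) => [|i|i j|i j|m|m] Hl.
- by exists (vx (Hub 0)); rewrite adj_vtx.
- have [Hi|Hi] := leqP i f.
    by exists (vx (Near i 0)); rewrite adj_vtx //=; label_arith.
  by exists (vx (Far f 0)); rewrite adj_vtx //=; label_arith.
- by exists (vx (Far i j)); rewrite adj_vtx //= !eqxx.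
- by exists (vx (Near i j)); rewrite adj_vtx //= !eqxx.
- by exists (vx (Far f 0)); rewrite adj_vtx //=; label_arith.
by exists (vx (Far f 0)); rewrite adj_vtx //=; label_arith.
Qed.

Lemma leaf_forced S m : geodetic_set S -> m < q -> vx (Leaf m) \in S.
Proof.
move=> gS Hm; apply: (leaf_in_geodetic (v := vx (Far f 0)) gS) => t.
case/(neighbour (l := Leaf m) Hm) => d [_ H ->]; congr vx.
by move: d H; label_cases.
Qed.

Lemma chord_forced S m : edge_geodetic_set S -> m < k -> vx (Chord m) \in S.
Proof.
move=> eS Hm; have okF : ok (Far f 0) by rewrite /=; lia.
have okC : ok (Chord m) := Hm.
apply: (enclosed_in_edge_geodetic (v := vx (Far f 0)) eS) => [|t].
  by rewrite (adj_vtx okF okC) /= !eqxx.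
case/(neighbour okC) => d [Hd H ->]; rewrite adj_vtx //.
case: d Hd H => [|i|i j|i j|m'|m'] //= Hd H.
- by right; lia.
- by right; lia.
by left; congr vx; f_equal; lia.
Qed.

Lemma shortcut u v s1 x p s2 m : geodesic u v (s1 ++ (x :: p) ++ s2) ->
  walk x (last x p) m -> size p < size m.
Proof. by move=> /geodesic_segment[_ H] /H. Qed.

Lemma near_link i j d : (i, j) != (f, 0) ->
  link f (Near i j) d || link f d (Near i j) -> d = Hub i \/ d = Far i j.
Proof.
rewrite xpair_eqE; case: d => [|i'|i' j'|i' j'|m|m] //= Dij H; try by lia.
  by left; f_equal; lia.
by right; f_equal; lia.
Qed.

Lemma far_link i j d : (i, j) != (f, 0) ->
  link f (Far i j) d || link f d (Far i j) -> d = Near i j \/ d = Hub i.+1.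
Proof.
rewrite xpair_eqE; case: d => [|i'|i' j'|i' j'|m|m] //= Dij H; try by lia.
  by right; f_equal; lia.
by left; f_equal; lia.
Qed.

Lemma strand_edge i j u v s : ok (Far i j) -> (i, j) != (f, 0) ->
  geodesic u v s -> vx (Far i j) \in s -> vx (Far i j) != u -> vx (Far i j) != v ->
  edge_on (vx (Near i j)) (vx (Far i j)) s.
Proof.
move=> okF Dij Hs Fs Du Dv; case/splitPr: Fs Hs => s1 s2 Hs.
have nbr t : adj (vx (Far i j)) t -> t = vx (Near i j) \/ t = vx (Hub i.+1).
  by case/(neighbour okF) => d [_ /(far_link Dij)[] -> ->]; [left | right].
have [r [t [E /[1!adj_sym]/nbr Ht]]] := walk_before Hs.1 Du.
have [t' [r' [E' /nbr Ht']]] := walk_after Hs.1 Dv.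
case: Ht => Ht; first by rewrite E Ht cat_rcons; apply: (edge_on_cat _ _ r s2).
case: Ht' => Ht'; first by rewrite E' Ht' edge_onC; apply: (edge_on_cat _ _ s1 r').
have := geodesic_uniq Hs; rewrite E E' Ht Ht' cat_uniq => /and3P[_ /hasP[]].
by exists (vx (Hub i.+1)); rewrite ?mem_rcons !inE eqxx ?orbT.
Qed.

(** Near i j and Far i j have degree two, since strand 0 of the last stage is
    excluded; so a geodesic that does not end there runs from hub to hub. *)
Lemma strand_extend i j u v s1 s2 : ok (Far i j) -> (i, j) != (f, 0) ->
  geodesic u v (s1 ++ [:: vx (Near i j); vx (Far i j)] ++ s2) ->
  vx (Near i j) != u -> vx (Far i j) != v ->
  exists r1 r2, [/\ s1 = rcons r1 (vx (Hub i)) & s2 = vx (Hub i.+1) :: r2].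
Proof.
move=> okF Dij Hs Du Dv; have okN : ok (Near i j) := okF.
have [r1 [t [E /[1!adj_sym] Ht]]] := walk_before Hs.1 Du.
have Hw : walk u v ((s1 ++ [:: vx (Near i j)]) ++ vx (Far i j) :: s2).
  by rewrite -catA; case: Hs.
have [t' [r2 [E' Ht']]] := walk_after Hw Dv.
exists r1, r2; have := geodesic_uniq Hs; rewrite E E' cat_rcons cat_uniq /= !inE.
case/and3P=> _ _ /and4P[/norP[_ /norP[Dt _]] /norP[_ /norP[Dt' _]] _ _].
split; first congr rcons; last congr (_ :: _).
  have [d [_ /(near_link Dij)[] -> // Ed]] := neighbour okN Ht.
  by rewrite Ed eqxx in Dt.
have [d [_ /(far_link Dij)[] -> // Ed]] := neighbour okF Ht'.
by rewrite Ed eqxx in Dt'.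
Qed.

Definition strand i j := [:: vx (Hub i); vx (Near i j); vx (Far i j); vx (Hub i.+1)].

Lemma strand_shape i j u v s : ok (Far i j) -> (i, j) != (f, 0) ->
  geodesic u v s -> edge_on (vx (Near i j)) (vx (Far i j)) s ->
  (forall x, x \in [:: u; v] -> x != vx (Near i j) /\ x != vx (Far i j)) ->
  exists s1 s2, s = s1 ++ strand i j ++ s2 \/ rev s = s1 ++ strand i j ++ s2.
Proof.
move=> okF Dij Hs /edge_onP[s1 [s2 E]] D.
have [[Du Du'] [Dv Dv']] : (u != vx (Near i j) /\ u != vx (Far i j)) /\
    (v != vx (Near i j) /\ v != vx (Far i j)).
  by split; apply: D; rewrite !inE eqxx ?orbT.
case: E => E.
  rewrite E in Hs; have [||r1 [r2 [E1 E2]]] := strand_extend okF Dij Hs; rewrite 1?eq_sym //.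
  by exists r1, r2; left; rewrite E E1 E2 cat_rcons.
have Hs' := geodesic_rev Hs; rewrite E in Hs'.
have [||r1 [r2 [E1 E2]]] := strand_extend okF Dij Hs'; rewrite 1?eq_sym //.
by exists r1, r2; right; rewrite E E1 E2 cat_rcons.
Qed.

(** All neighbours of H_{f+1} are within distance two of H_f, so the geodesic
    stops at H_{f+1}; all vertices above H_f are within distance two of H_{f+1},
    so it starts at H_f or below. *)
Lemma last_strand_end u v s1 s2 j : 0 < j < n ->
  geodesic u v (s1 ++ strand f j ++ s2) ->
  [/\ s2 = [::], v = vx (Hub f.+1) & lev u <= (3 * f).+1].
Proof.
move=> Hj Hs; have okH := last_ok; have okHf : ok (Hub f) := leqnSn _.
have okN0 : ok (Near f 0) by rewrite /=; lia.
have Es2 : s2 = [::].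
  case: s2 Hs => // t s2 Hs.
  have Hs' : geodesic u v (s1 ++ (vx (Hub f) ::
      [:: vx (Near f j); vx (Far f j); vx (Hub f.+1); t]) ++ s2) := Hs.
  have Ht : adj (vx (Hub f.+1)) t.
    have [/= /and3P[_ H _] _] := geodesic_segment Hs'.
    by case/and5P: H.
  have [d [Hd H Ed]] := neighbour okH Ht.
  have [c [Hc H1 H2]] : exists c, [/\ ok c, link f (Hub f) c & link f c d].
    case: d Hd H {Ed} => [|i|i j'|i j'|m|m] //= Hd H; try by lia.
      by exists (Near f j'); rewrite /=; split; lia.
    by exists (Near f 0); rewrite /=; split; lia.
  have /(shortcut Hs') : walk (vx (Hub f)) t [:: vx (Hub f); vx c; t].
    by rewrite Ed /= !adj_vtx // H1 H2 !eqxx.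
  by [].
rewrite Es2 in Hs *.
have Ev : v = vx (Hub f.+1).
  have := Hs.1; rewrite cats0 /strand -[[:: _; _; _; _]]/(rcons [:: _; _; _] _) -rcons_cat.
  by move/walk_last.
split=> //; rewrite leqNgt; apply/negP => Hu.
suff [m Hm Hsz] : exists2 m, walk u v m & size m <= 3.
  by have := Hs.2 m Hm; rewrite !size_cat /=; lia.
have okF0 : ok (Far f 0) by rewrite /=; lia.
rewrite Ev; move: Hu; rewrite /lev -{2}(labK N u).
case: (lbl u) (lab_valid N u) => [|i|i j'|i j'|m|m] //= Hl Hu.
- have -> : i = f.+1 by lia.
  by exists [:: vx (Hub f.+1)]; rewrite /= ?eqxx.
- have Ei : i = f by lia.
  rewrite Ei in Hl *; have okN : ok (Near f j') := Hl; have okF : ok (Far f j') := Hl.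
  exists [:: vx (Near f j'); vx (Far f j'); vx (Hub f.+1)] => //.
  by rewrite /= !adj_vtx //= !eqxx.
- have Ei : i = f by lia.
  rewrite Ei in Hl *; have okF : ok (Far f j') := Hl.
  by exists [:: vx (Far f j'); vx (Hub f.+1)]; rewrite //= !adj_vtx //= !eqxx.
- exists [:: vx (Leaf m); vx (Far f 0); vx (Hub f.+1)] => //.
  by rewrite /= !adj_vtx //= !eqxx.
by exists [:: vx (Chord m); vx (Hub f.+1)]; rewrite //= !adj_vtx //= !eqxx.
Qed.

(** The tail is pendant. Without it, a geodesic through H_0 with both ends at H_f
    or above would come down one strand of the first stage and climb the other,
    although the hub H_1 is a shortcut. *)
Lemma low_meets S : geodetic_set S -> exists2 x, x \in S & lev x <= 3 * f.
Proof.
move=> gS; case: rootP => [[Hp _]|[Hp _]].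
  exists (vx Tail); last by rewrite lev_vtx.
  apply: (leaf_in_geodetic (v := vx (Hub 0)) gS) => t.
  case/(neighbour (l := Tail) Hp) => d [_ H ->]; congr vx.
  by move: d H; label_cases.
have f0 : 0 < f by move: root_low; rewrite (negPf Hp).
have [u [v [s [uS vS Duv Hs Hin]]]] := gS (vx (Hub 0)).
have [|Hu] := leqP (lev u) (3 * f); first by exists u.
have [|Hv] := leqP (lev v) (3 * f); first by exists v.
exfalso; case/splitPr: Hin Hs => s1 s2 Hs.
have okH1 : ok (Hub 1) by rewrite /=; lia.
have nbr0 t : adj (vx (Hub 0)) t -> exists2 j, j < 2 & t = vx (Near 0 j).
  case/(neighbour (l := Hub 0) isT) => d [Hd H ->].
  case: d Hd H => [|i|i j|i j|m|m] //= Hd H; try by lia.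
  by exists j; [lia | congr vx; f_equal; lia].
have okN j : j < 2 -> ok (Near 0 j) by rewrite /=; lia.
have okF j : j < 2 -> ok (Far 0 j) by rewrite /=; lia.
have nbr1 j t : j < 2 -> adj (vx (Near 0 j)) t -> t = vx (Hub 0) \/ t = vx (Far 0 j).
  move=> Hj /(neighbour (okN j Hj))[d [Hd H ->]].
  case: d Hd H => [|i|i j'|i j'|m|m] //= Hd H; try by lia.
    by left; congr vx; f_equal; lia.
  by right; congr vx; f_equal; lia.
have high l : ok l -> lvl l <= 3 * f -> vx l != u /\ vx l != v.
  move=> Hl Hlt; split; apply: contraTneq Hlt => E; rewrite -ltnNge.
    by rewrite -(lev_vtx Hl) E.
  by rewrite -(lev_vtx Hl) E.
have [D0u D0v] : vx (Hub 0) != u /\ vx (Hub 0) != v by apply: high => //=; lia.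
have [r1 [t [E1 /[1!adj_sym]/nbr0[j Hj Et]]]] := walk_before Hs.1 D0u.
have [t' [r2 [E2 /nbr0[j' Hj' Et']]]] := walk_after Hs.1 D0v.
have [DNu _] : vx (Near 0 j) != u /\ vx (Near 0 j) != v.
  by apply: high; [exact: okN | rewrite /=; lia].
have [_ DNv] : vx (Near 0 j') != u /\ vx (Near 0 j') != v.
  by apply: high; [exact: okN | rewrite /=; lia].
rewrite E1 E2 Et Et' cat_rcons in Hs.
have Hw : walk u v ((r1 ++ [:: vx (Near 0 j); vx (Hub 0)]) ++ vx (Near 0 j') :: r2).
  by rewrite -catA; case: Hs.
have [q1 [w [F1 /[1!adj_sym] Hw1]]] := walk_before Hs.1 DNu.
have [w' [q2 [F2 Hw2]]] := walk_after Hw DNv.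
have := geodesic_uniq Hs; rewrite F1 F2 cat_rcons cat_uniq /= !inE => /and3P[_ _].
case/and5P=> /norP[_ /norP[Dw _]] _ /norP[_ /norP[Dw' _]] _ _.
have Ew : w = vx (Far 0 j).
  by case: (nbr1 j w Hj Hw1) => // E; rewrite E eqxx in Dw.
have Ew' : w' = vx (Far 0 j').
  by case: (nbr1 j' w' Hj' Hw2) => // E; rewrite E eqxx in Dw'.
rewrite F1 F2 Ew Ew' cat_rcons in Hs.
have Hs' : geodesic u v (q1 ++ (vx (Far 0 j) :: [:: vx (Near 0 j); vx (Hub 0);
    vx (Near 0 j'); vx (Far 0 j')]) ++ q2) := Hs.
have /(shortcut Hs') : walk (vx (Far 0 j)) (vx (Far 0 j'))
    [:: vx (Far 0 j); vx (Hub 1); vx (Far 0 j')].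
  by rewrite /= !adj_vtx ?okF //= !eqxx.
by [].
Qed.

Lemma right_meets S : geodetic_set S ->
  exists2 x, x \in S & lbl x \in [:: Near f 1; Far f 1; Hub f.+1].
Proof.
move=> gS; have okF : ok (Far f 1) by rewrite /=; lia.
have okN : ok (Near f 1) := okF.
have D1 : (f, 1) != (f, 0) by rewrite xpair_eqE andbF.
have [u [v [s [uS vS Duv Hs Hin]]]] := gS (vx (Far f 1)).
have [Hu|Hu] := boolP (lbl u \in [:: Near f 1; Far f 1; Hub f.+1]); first by exists u.
have [Hv|Hv] := boolP (lbl v \in [:: Near f 1; Far f 1; Hub f.+1]); first by exists v.
have D x : lbl x \notin [:: Near f 1; Far f 1; Hub f.+1] ->
    [/\ x != vx (Near f 1), x != vx (Far f 1) & x != vx (Hub f.+1)].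
  by move=> Hx; split; apply: contraNneq Hx => ->; rewrite (vtxK N) ?last_ok // !inE eqxx ?orbT.
have [Du1 Du2 Du3] := D u Hu; have [Dv1 Dv2 Dv3] := D v Hv.
have He : edge_on (vx (Near f 1)) (vx (Far f 1)) s.
  by apply: strand_edge Hs Hin _ _ => //; rewrite eq_sym.
have [|s1 [s2 [E|E]]] := strand_shape okF D1 Hs He.
- by move=> x; rewrite !inE => /orP[] /eqP->.
- rewrite E in Hs; have [_ Ev _] := last_strand_end (n_gt1 : 0 < 1 < n) Hs.
  by rewrite Ev eqxx in Dv3.
have Hs' := geodesic_rev Hs; rewrite E in Hs'.
have [_ Ev _] := last_strand_end (n_gt1 : 0 < 1 < n) Hs'.
by rewrite Ev eqxx in Du3.
Qed.

(** Counting distinct keys avoids naming the vertices that [low_meets] and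
    [right_meets] provide. *)
Definition coarse_key x :=
  if lev x <= 3 * f then Tail else
  match lbl x with Leaf m => Leaf m | Chord m => Chord m | _ => Hub 0 end.

Lemma coarse_count S t : geodetic_set S ->
  uniq t -> (forall l, l \in t -> l \in leaves ++ chords) ->
  (forall l, l \in t -> vx l \in S) -> size t + 2 <= #|S|.
Proof.
move=> gS Ut tf tS.
have -> : size t + 2 = size [:: Tail, Hub 0 & t] by rewrite addn2.
apply: (card_keys (key := coarse_key)).
  have notin l : l \notin leaves ++ chords -> l \notin t by apply/contra/tf.
  by rewrite /= Ut !inE !notin // mem_cat !mem_labels.
move=> l; rewrite !inE => /or3P[/eqP->|/eqP->|lt].
- by have [x xS Hx] := low_meets gS; exists x; rewrite // /coarse_key Hx.
- have [x xS Hx] := right_meets gS; exists x => //.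
  have Hlev : (lev x <= 3 * f) = false.
    by apply: negbTE; move: Hx; rewrite /lev !inE => /or3P[] /eqP->; rewrite /=; lia.
  by move: Hx; rewrite /coarse_key Hlev !inE => /or3P[] /eqP->.
have Hl : ok l.
  by move: (tf l lt); rewrite mem_cat !mem_labels; case: l {lt} => //= m; rewrite orbF.
exists (vx l); first exact: tS.
rewrite /coarse_key (lev_vtx Hl) (vtxK N Hl).
move: (tf l lt); rewrite mem_cat !mem_labels; case: l {lt Hl} => //= m _.
  by rewrite ifF //; lia.
by rewrite ifF //; lia.
Qed.

Lemma geodetic_lower S : geodetic_set S -> q + 2 <= #|S|.
Proof.
move=> gS; have := coarse_count gS leaves_uniq; rewrite size_map size_iota; apply.
  by move=> l Hl; rewrite mem_cat Hl.
by move=> l; rewrite mem_leaves; case: l => // m; apply: leaf_forced.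
Qed.

Lemma forced_in S l : edge_geodetic_set S -> l \in leaves ++ chords -> vx l \in S.
Proof.
move=> eS; have gS := edge_geodetic_geodetic has_neighbour eS.
rewrite mem_cat !mem_labels; case: l => // m; rewrite ?orbF /=.
  exact: leaf_forced.
exact: chord_forced.
Qed.

Lemma edge_geodetic_lower S : edge_geodetic_set S -> q + k + 2 <= #|S|.
Proof.
move=> eS; have gS := edge_geodetic_geodetic has_neighbour eS.
have := coarse_count gS forced_labels_uniq; rewrite size_cat !size_map !size_iota.
by apply=> // l; apply: forced_in.
Qed.

(** The two inner vertices of a last-stage strand share a key. What the low
    vertices stand for depends on the case in [strong_lower]: either all for a
    single label, or each for the strand that its chosen path to H_{f+1} goes
    through. *)
Definition strand_key (g : G -> label) x :=
  if lev x <= (3 * f).+1 then g x else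
  match lbl x with Near i j => Far i j | l => l end.

Lemma strand_count S g h : edge_geodetic_set S ->
  h \notin leaves ++ chords ++ far_ends ->
  (exists2 x, x \in S & strand_key g x = h) ->
  (forall j, 0 < j < n -> exists2 x, x \in S & strand_key g x = Far f j) ->
  q + k + n <= #|S|.
Proof.
move=> eS Hh [x0 x0S Ex0] Hj.
have -> : q + k + n = size (h :: leaves ++ chords ++ far_ends).
  by rewrite /= !size_cat !size_map !size_iota; move: n_gt1; lia.
apply: (card_keys (key := strand_key g)).
  by rewrite cons_uniq Hh right_labels_uniq.
move=> l; rewrite inE catA => /orP[/eqP->|]; first by exists x0.
rewrite mem_cat => /orP[Hl|]; last first.
  rewrite mem_far_ends; case: l => // i j /and3P[/eqP-> H0 H1].
  by apply: Hj; rewrite H0.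
have okl : ok l.
  by move: Hl; rewrite mem_cat !mem_labels; case: l => //= m; rewrite orbF.
exists (vx l); first exact: forced_in.
rewrite /strand_key (lev_vtx okl) (vtxK N okl).
by move: Hl; rewrite mem_cat !mem_labels; case: l {okl} => //= m _; rewrite ifF //; lia.
Qed.

(** A strand without chosen vertices is covered by the path from some low vertex
    to H_{f+1}; the last four vertices of that path name the strand, so different
    such strands use different low vertices. *)
Lemma strong_lower S : strong_edge_geodetic_set S -> q + k + n <= #|S|.
Proof.
move=> sS; have eS := strong_edge_geodetic sS.
have gS := edge_geodetic_geodetic has_neighbour eS.
have okF j : 0 < j < n -> ok (Far f j) by rewrite /=; lia.
have okN j : 0 < j < n -> ok (Near f j) by rewrite /=; lia.
case: sS => P [HP cov].
pose hit j := (vx (Near f j) \in S) || (vx (Far f j) \in S).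
have hit_key g j : 0 < j < n -> hit j ->
    exists2 x, x \in S & strand_key g x = Far f j.
  move=> Hj /orP[] H; [exists (vx (Near f j)) | exists (vx (Far f j))] => //.
    by rewrite /strand_key (lev_vtx (okN j Hj)) (vtxK N (okN j Hj)) ifF //= ltnn.
  by rewrite /strand_key (lev_vtx (okF j Hj)) (vtxK N (okF j Hj)) ifF //=; lia.
have unhit j : 0 < j < n -> ~~ hit j -> exists x s,
    [/\ x \in S, vx (Hub f.+1) \in S, lev x <= (3 * f).+1 &
        P x (vx (Hub f.+1)) = s ++ strand f j].
  move=> Hj /norP[notN notF].
  have Dj : (f, j) != (f, 0) by rewrite xpair_eqE; lia.
  have adjj : adj (vx (Near f j)) (vx (Far f j)).
    by rewrite (adj_vtx (okN j Hj) (okF j Hj)) /= !eqxx.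
  have [u [v [uS vS Duv He]]] := cov _ _ adjj.
  have [Hs Erev] := HP u v uS vS Duv.
  have [|s1 [s2 [E|E]]] := strand_shape (okF j Hj) Dj Hs He.
  - move=> x Hx; have xS : x \in S by move: Hx; rewrite !inE => /orP[] /eqP->.
    by split; apply: contraTneq xS => ->.
  - rewrite E in Hs; have [E2 Ev Hu] := last_strand_end Hj Hs.
    by exists u, s1; rewrite -Ev; split=> //; rewrite E E2 cats0.
  have Hs' := geodesic_rev Hs; rewrite E in Hs'.
  have [E2 Ev Hu] := last_strand_end Hj Hs'.
  by exists v, s1; rewrite -Ev; split=> //; rewrite Erev E E2 cats0.
have [allhit|] := boolP [forall j : 'I_n, (0 < j) ==> hit j].
  apply: (strand_count (g := fun=> Tail) (h := Tail)) => //.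
  - by rewrite !mem_cat !mem_labels.
  - have [x xS Hx] := low_meets gS; exists x => //.
    by rewrite /strand_key (leqW Hx).
  move=> j Hj; apply: hit_key => //; case/andP: Hj => j0 jn.
  by have := forallP allhit (Ordinal jn); rewrite /= j0.
case/forallPn=> j; rewrite negb_imply => /andP[j0 nhj].
have Hjn : 0 < j < n by rewrite j0 ltn_ord.
have [_ [_ [_ yS _ _]]] := unhit j Hjn nhj.
(* The last vertex but one of a path that covers strand j is Far f j. *)
pose g x := lbl (nth x (rev (P x (vx (Hub f.+1)))) 1).
apply: (strand_count (g := g) (h := Hub f.+1)) => //.
- by rewrite !mem_cat !mem_labels.
- exists (vx (Hub f.+1)) => //.
  rewrite /strand_key (lev_vtx last_ok) (vtxK N last_ok) ifF //=; lia.
move=> i Hi; have [/hit_key|nhi] := boolP (hit i); first exact.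
have [x [s [xS _ Hx Ex]]] := unhit i Hi nhi; exists x => //.
by rewrite /strand_key Hx /g Ex rev_cat /= (vtxK N (okF i Hi)).
Qed.

Lemma detour_ok i j : ok (Far i j) -> ok (Far i (j == 0)).
Proof. by rewrite /=; case: (j == 0); move: n_gt1; lia. Qed.

(** Otherwise rerouting the geodesic along a parallel strand, which has the same
    length, gives a geodesic that avoids the edge. *)
Lemma strand_hit S i j : meg_set S -> ok (Far i j) -> (i, j) != (f, 0) ->
  (vx (Near i j) \in S) || (vx (Far i j) \in S).
Proof.
move=> mS okF Dij; have okN : ok (Near i j) := okF.
have Hi : i <= f by case/and3P: okF.
have okH : ok (Hub i) := leqW Hi; have okH1 : ok (Hub i.+1) by [].
apply/negPn/negP => /norP[notN notF].
have adjNF : adj (vx (Near i j)) (vx (Far i j)) by rewrite (adj_vtx okN okF) /= !eqxx.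
have [u [v [uS vS Duv mon]]] := mS _ _ adjNF.
have [s Hs] := geod u v.
have [|s1 [s2 E]] := strand_shape okF Dij Hs (mon s Hs).
  move=> x Hx; have xS : x \in S by move: Hx; rewrite !inE => /orP[] /eqP->.
  by split; apply: contraTneq xS => ->.
have [s' Hs' [E' mon']] : exists2 s, geodesic u v s \/ geodesic v u s &
    s = s1 ++ strand i j ++ s2 /\ forall r, geodesic u v r \/ geodesic v u r ->
      edge_on (vx (Near i j)) (vx (Far i j)) r.
  have mon' r : geodesic u v r \/ geodesic v u r -> edge_on (vx (Near i j)) (vx (Far i j)) r.
    by case=> [/mon//|/geodesic_rev/mon]; rewrite edge_on_rev.
  case: E => E; first by exists s => //; left.
  by exists (rev s) => //; right; apply: geodesic_rev.
pose c : nat := (j == 0).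
have okFc : ok (Far i c) := detour_ok okF.
have okNc : ok (Near i c) := okFc.
have Dc : c != j by rewrite /c; case: (j).
have wj : walk (vx (Hub i)) (vx (Hub i.+1)) (strand i j) by rewrite /= !adj_vtx //= !eqxx.
have wc : walk (vx (Hub i)) (vx (Hub i.+1)) (strand i c) by rewrite /= !adj_vtx //= !eqxx.
have Us' : uniq s' by case: Hs' => /geodesic_uniq.
have Hc : geodesic u v (s1 ++ strand i c ++ s2) \/ geodesic v u (s1 ++ strand i c ++ s2).
  by rewrite E' in Hs'; case: Hs' => Hs'; [left | right]; apply: geodesic_subst Hs' wj wc _.
have := edge_on_mem (mon' _ Hc); move: Us'; rewrite E' !mem_cat !cat_uniq.
case/and3P=> _ H1 /and3P[_ H2 _] /or3P[H|H|H].
- by case/hasP: H1; exists (vx (Near i j)); rewrite ?mem_cat ?inE ?eqxx ?orbT.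
- move: H; rewrite !inE => /or4P[] /eqP/vtx_inj E0; have := E0 okN.
  + by move/(_ okH).
  + by case/(_ okNc) => Ej; rewrite Ej eqxx in Dc.
  + by move/(_ okFc).
  by move/(_ okH1).
by case/hasP: H2; exists (vx (Near i j)); rewrite ?inE ?eqxx ?orbT.
Qed.

(** Both inner vertices of a strand are sent to the one that [meg_labels] lists,
    if it lists one. *)
Definition meg_key x :=
  match lbl x with
  | Near i j => if i < f then Near i j else Far i j
  | Far i j => if i < f then Near i j else Far i j
  | l => l
  end.

Lemma meg_lower S : meg_set S -> pend + 2 * f + q + k + n.-1 <= #|S|.
Proof.
move=> mS; have eS := meg_edge_geodetic geod mS.
have gS := edge_geodetic_geodetic has_neighbour eS.
rewrite -size_meg_labels; apply: (card_keys (key := meg_key)) meg_labels_uniq _ => l Hl.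
have okl := allP meg_labels_ok l Hl.
have strand_rep i j : ok (Far i j) -> (i, j) != (f, 0) ->
    exists2 x, x \in S & meg_key x = if i < f then Near i j else Far i j.
  move=> okF Dij; case/orP: (strand_hit mS okF Dij) => H.
    by exists (vx (Near i j)); rewrite // /meg_key (vtxK N (okF : ok (Near i j))).
  by exists (vx (Far i j)); rewrite // /meg_key (vtxK N okF).
move: Hl; rewrite !mem_cat !mem_labels.
case: l okl => [|i|i j|i j|m|m] //= okl; rewrite ?orbF => Hl.
- exists (vx Tail); last by rewrite /meg_key (vtxK N (okl : ok Tail)).
  apply: (leaf_in_geodetic (v := vx (Hub 0)) gS) => t.
  case/(neighbour (l := Tail) okl) => d [_ H ->]; congr vx.
  by move: d H; label_cases.
- have [|x xS Hx] := strand_rep i j okl; first by rewrite xpair_eqE; lia.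
  by exists x; rewrite // Hx ifT //; lia.
- have [|x xS Hx] := strand_rep i j okl; first by rewrite xpair_eqE; lia.
  by exists x; rewrite // Hx ifF //; lia.
- exists (vx (Leaf m)); first exact: leaf_forced.
  by rewrite /meg_key (vtxK N (okl : ok (Leaf m))).
exists (vx (Chord m)); first exact: chord_forced.
by rewrite /meg_key (vtxK N (okl : ok (Chord m))).
Qed.

Theorem network_numbers :
  [/\ geodetic_number G (q + 2), edge_geodetic_number G (q + k + 2),
      strong_edge_geodetic_number G (q + k + n) &
      meg_number G (pend + 2 * f + q + k + n.-1)].
Proof.
split; split.
- exists (vset geodetic_labels); first exact: geodetic_upper.
  by rewrite card_vset ?geodetic_labels_uniq ?geodetic_labels_ok // size_geodetic_labels.
- exact: geodetic_lower.
- exists (vset edge_geodetic_labels); first exact: edge_geodetic_upper.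
  rewrite card_vset ?edge_geodetic_labels_uniq ?edge_geodetic_labels_ok //.
  exact: size_edge_geodetic_labels.
- exact: edge_geodetic_lower.
- exists (vset strong_labels); first exact: strong_upper.
  by rewrite card_vset ?strong_labels_uniq ?strong_labels_ok // size_strong_labels.
- exact: strong_lower.
- exists (vset meg_labels); first exact: meg_upper.
  by rewrite card_vset ?meg_labels_uniq ?meg_labels_ok // size_meg_labels.
exact: meg_lower.
Qed.

End Network.

(** * Numbering the vertices *)

Ltac split_strands := repeat
  match goal with |- context [if ?j < 2 then _ else _] => case: (ltnP j 2) => ? end.

Section Coding.
Variables (f n q k : nat) (pend : bool).
Hypothesis n_gt1 : 1 < n.

(** The order of creation: stage by stage, hub H_i having number 5i, with only
    two strands in each; then the other strands of the last stage, the leaves,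
    the chords and the tail. *)
Definition code (l : label) : nat :=
  match l with
  | Hub i => 5 * i
  | Near i j => if j < 2 then 5 * i + 1 + 2 * j else 5 * f + 6 + 2 * (j - 2)
  | Far i j => if j < 2 then 5 * i + 2 + 2 * j else 5 * f + 7 + 2 * (j - 2)
  | Leaf m => 5 * f + 6 + 2 * (n - 2) + m
  | Chord m => 5 * f + 6 + 2 * (n - 2) + q + m
  | Tail => 5 * f + 6 + 2 * (n - 2) + q + k
  end.

Definition vertex_count := 5 * f + 6 + 2 * (n - 2) + q + k + pend.

Local Notation ok := (valid f n q k pend).

Lemma code_lt l : ok l -> code l < vertex_count.
Proof.
by rewrite /vertex_count; case: l => [|i|i j|i j|m|m] /=; split_strands; lia.
Qed.

Lemma code_inj l l' : ok l -> ok l' -> code l = code l' -> l = l'.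
Proof.
case: l => [|i|i j|i j|m|m]; case: l' => [|i'|i' j'|i' j'|m'|m'] //=;
  split_strands; move=> ? ? ?;
  first [by exfalso; lia | by f_equal; lia].
Qed.

Lemma code_onto x : x < vertex_count -> exists2 l, ok l & code l = x.
Proof.
rewrite /vertex_count => Hx.
have [H1|H1] := ltnP x (5 * f + 6).
  have [r0|[r1|[r2|[r3|r4]]]] : x %% 5 = 0 \/ x %% 5 = 1 \/ x %% 5 = 2 \/ x %% 5 = 3 \/ x %% 5 = 4.
  - by lia.
  - by exists (Hub (x %/ 5)) => /=; lia.
  - by exists (Near (x %/ 5) 0) => /=; lia.
  - by exists (Far (x %/ 5) 0) => /=; lia.
  - by exists (Near (x %/ 5) 1) => /=; lia.
  by exists (Far (x %/ 5) 1) => /=; lia.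
have [H2|H2] := ltnP x (5 * f + 6 + 2 * (n - 2)).
  pose y := x - (5 * f + 6).
  have [r0|r1] : y %% 2 = 0 \/ y %% 2 = 1 by lia.
    by exists (Near f (y %/ 2 + 2)) => /=; rewrite ?ifF /y in r0 *; lia.
  by exists (Far f (y %/ 2 + 2)) => /=; rewrite ?ifF /y in r1 *; lia.
have [H3|H3] := ltnP x (5 * f + 6 + 2 * (n - 2) + q).
  by exists (Leaf (x - (5 * f + 6 + 2 * (n - 2)))) => /=; lia.
have [H4|H4] := ltnP x (5 * f + 6 + 2 * (n - 2) + q + k).
  by exists (Chord (x - (5 * f + 6 + 2 * (n - 2) + q))) => /=; lia.
by exists Tail => /=; lia.
Qed.

Definition codes_links (b : build) :=
  Defs.order b = vertex_count /\
  forall e, e \in edges b <->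
    exists l l', [/\ ok l, ok l', link f l l' & e = (code l, code l')].

Lemma link_irr l : link f l l = false.
Proof. by case: l => //= i; lia. Qed.

Lemma network_of_codes (b : build) :
  codes_links b -> inhabited (network f n q k pend (graph_of b)).
Proof.
case=> Eo Ee; have o_gt0 : 0 < Defs.order b by rewrite Eo /vertex_count; lia.
pose v l : 'I_(Defs.order b) := insubd (Ordinal o_gt0) (code l).
have vE l : ok l -> (v l : nat) = code l.
  by move=> Hl; rewrite /v val_insubd ifT // Eo code_lt.
have onto (x : 'I_(Defs.order b)) : exists l, ok l && (code l == x).
  have [|l Hl Hc] := @code_onto x; first by rewrite -Eo ltn_ord.
  by exists l; rewrite Hl Hc eqxx.
have [lab0 Hlab] := fin_all_exists onto.
have lab_ok x : ok (lab0 x) by case/andP: (Hlab x).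
have lab_code x : code (lab0 x) = x by case/andP: (Hlab x) => _ /eqP.
have edgeE (x y : 'I_(Defs.order b)) : ((x : nat, y : nat) \in edges b) = link f (lab0 x) (lab0 y).
  apply/idP/idP => [/Ee[l [l' [Hl Hl' H [Ex Ey]]]]|H].
    have -> : lab0 x = l by apply: code_inj; rewrite ?lab_code.
    by have -> : lab0 y = l' by apply: code_inj; rewrite ?lab_code.
  by apply/Ee; exists (lab0 x), (lab0 y); rewrite !lab_code; split.
constructor; apply: (@Network _ _ _ _ _ (graph_of b) lab0 v) => //.
- by move=> x; apply: val_inj; rewrite /= vE.
- by move=> l Hl; apply: code_inj; rewrite // lab_code vE.
move=> x y; rewrite /adj /= /build_adj !edgeE.
by have [->|_] := eqVneq x y; rewrite ?link_irr.
Qed.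

End Coding.

Definition stage_edges z := [:: (z, z + 1); (z + 1, z + 2); (z + 2, z + 5);
  (z, z + 3); (z + 3, z + 4); (z + 4, z + 5)].
Definition strand_edges z v := [:: (z, v); (v, v + 1); (v + 1, z + 5)].
Definition leaf_edges (z v : nat) := [:: (z + 2, v)].
Definition chord_edges z v := [:: (z + 1, v); (z + 2, v); (v, z + 5)].

(** The edges in the order in which the program adds them. *)
Definition edge_codes (f n q k : nat) (pend : bool) (e : nat * nat) : Prop :=
  let w := 5 * f + 6 in let v := w + 2 * (n - 2) in
  (exists2 i, i < f.+1 & e \in stage_edges (5 * i)) \/
  (exists2 j, j < n - 2 & e \in strand_edges (5 * f) (w + 2 * j)) \/
  (exists2 m, m < q & e \in leaf_edges (5 * f) (v + m)) \/
  (exists2 m, m < k & e \in chord_edges (5 * f) (v + q + m)) \/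
  (pend /\ e = (v + q + k, 0)).

Lemma edge_codesP f n q k pend e : 1 < n -> edge_codes f n q k pend e <->
  exists l l', [/\ valid f n q k pend l, valid f n q k pend l', link f l l' &
                   e = (code f n q k l, code f n q k l')].
Proof.
move=> n_gt1; rewrite /edge_codes; split.
  case=> [[i Hi]|[[j Hj]|[[m Hm]|[[m Hm]|[Hp ->]]]]].
  - rewrite !inE => /orP[/eqP->|/orP[/eqP->|/orP[/eqP->|/orP[/eqP->|/orP[/eqP->|/eqP->]]]]].
    + by exists (Hub i), (Near i 0) => /=; split; try lia; congr (_, _); lia.
    + by exists (Near i 0), (Far i 0) => /=; split; try lia; congr (_, _); lia.
    + by exists (Far i 0), (Hub i.+1) => /=; split; try lia; congr (_, _); lia.
    + by exists (Hub i), (Near i 1) => /=; split; try lia; congr (_, _); lia.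
    + by exists (Near i 1), (Far i 1) => /=; split; try lia; congr (_, _); lia.
    by exists (Far i 1), (Hub i.+1) => /=; split; try lia; congr (_, _); lia.
  - rewrite !inE => /orP[/eqP->|/orP[/eqP->|/eqP->]].
    + by exists (Hub f), (Near f j.+2) => /=; split; try lia; congr (_, _); lia.
    + by exists (Near f j.+2), (Far f j.+2) => /=; split; try lia; congr (_, _); lia.
    by exists (Far f j.+2), (Hub f.+1) => /=; split; try lia; congr (_, _); lia.
  - rewrite !inE => /eqP->.
    by exists (Far f 0), (Leaf m) => /=; split; try lia; congr (_, _); lia.
  - rewrite !inE => /orP[/eqP->|/orP[/eqP->|/eqP->]].
    + by exists (Near f 0), (Chord m) => /=; split; try lia; congr (_, _); lia.
    + by exists (Far f 0), (Chord m) => /=; split; try lia; congr (_, _); lia.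
    by exists (Chord m), (Hub f.+1) => /=; split; try lia; congr (_, _); lia.
  by exists Tail, (Hub 0) => /=; split.
case=> l [l' [Hl Hl' H ->]].
case: l Hl H => [|i|i j|i j|m|m]; case: l' Hl' => [|i'|i' j'|i' j'|m'|m'] //= Hl' Hl H.
- by do 4 right; split=> //; congr (_, _); lia.
- have Ei : i' = i by lia.
  rewrite Ei in Hl' *; case: j' Hl' => [|[|j]] Hl' /=.
  + by left; exists i; [lia | rewrite !inE !xpair_eqE; lia].
  + by left; exists i; [lia | rewrite !inE !xpair_eqE; lia].
  have -> : i = f by lia.
  by right; left; exists j; [lia | rewrite !inE !xpair_eqE; lia].
- have [Ei Ej] : i' = i /\ j' = j by lia.
  rewrite Ei Ej in Hl' *; case: j Hl' {Hl H Ej} => [|[|j]] Hl' /=.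
  + by left; exists i; [lia | rewrite !inE !xpair_eqE; lia].
  + by left; exists i; [lia | rewrite !inE !xpair_eqE; lia].
  by right; left; exists j; [lia | rewrite !inE !xpair_eqE; lia].
- have [-> ->] : i = f /\ j = 0 by lia.
  by do 3 right; left; exists m' => //; rewrite !inE !xpair_eqE /=; lia.
- have -> : i' = i.+1 by lia.
  case: j Hl {H} => [|[|j]] Hl /=.
  + by left; exists i; [lia | rewrite !inE !xpair_eqE; lia].
  + by left; exists i; [lia | rewrite !inE !xpair_eqE; lia].
  have -> : i = f by lia.
  by right; left; exists j; [lia | rewrite !inE !xpair_eqE; lia].
- have [-> ->] : i = f /\ j = 0 by lia.
  by do 2 right; left; exists m' => //; rewrite !inE !xpair_eqE /=; lia.
- have [-> ->] : i = f /\ j = 0 by lia.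
  by do 3 right; left; exists m' => //; rewrite !inE !xpair_eqE /=; lia.
have -> : i' = f.+1 by lia.
by do 3 right; left; exists m => //; rewrite !inE !xpair_eqE /=; lia.
Qed.

(** * The program *)

Definition assertion := store -> build -> Prop.

Definition runs (t0 : nat) (P : assertion) (p : program) (Q : assertion) :=
  forall m b, P m b -> exists t m' b', [/\ exec p m b t m' b', t <= t0 & Q m' b'].

Lemma runs_seq t1 t2 P R Q p1 p2 :
  runs t1 P p1 R -> runs t2 R p2 Q -> runs (t1 + t2) P (Seq p1 p2) Q.
Proof.
move=> H1 H2 m b /H1[u1 [m1 [b1 [X1 L1 /H2[u2 [m2 [b2 [X2 L2 HQ]]]]]]]].
exists (u1 + u2), m2, b2; split=> //; [exact: ExecSeq X1 X2 | exact: leq_add].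
Qed.

(** The invariant is indexed by the number of turns that are left. *)
Lemma runs_while t0 (I : nat -> assertion) e p i :
  (forall j m b, I j m b -> (eval m e == 0) = (j == 0)) ->
  (forall j, runs t0 (I j.+1) p (I j)) ->
  runs (i * t0.+1 + 1) (I i) (While e p) (I 0).
Proof.
move=> He Hp; elim: i => [|i IH] m b HI.
  exists 1, m, b; split=> //; apply: ExecWhileFalse.
  by apply/eqP; rewrite (He _ _ _ HI).
have [t1 [m1 [b1 [X1 L1 /IH[t2 [m2 [b2 [X2 L2 HQ]]]]]]]] := Hp i m b HI.
exists (t1 + t2).+1, m2, b2; split=> //; last by rewrite mulSn; lia.
by apply: ExecWhileTrue X1 X2; rewrite (He _ _ _ HI).
Qed.

(** Registers beyond those that s lists hold 0. *)
Definition in_state (s : seq nat) (o : nat) (E : nat * nat -> Prop) : assertion :=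
  fun m b => [/\ m =1 nth 0 s, Defs.order b = o & forall e, e \in edges b <-> E e].

Lemma add_edge_new i j b : i < Defs.order b -> j < Defs.order b -> i != j ->
  add_edge i j b = Build (Defs.order b) ((i, j) :: edges b).
Proof. by rewrite /add_edge => -> -> ->. Qed.

Local Notation "p ;; p'" := (Seq p p') (at level 60, right associativity).

Definition add_vertices i (p : program) : program := iter i (Seq AddVertex) p.

Definition add_edges (es : seq (expr * expr)) (p : program) : program :=
  foldr (fun e => Seq (AddEdge e.1 e.2)) p es.

Definition offset r i := Add (Reg r) (Const i).

Definition stage_program : program :=
  add_vertices 5 (add_edges
    [:: (Reg 5, offset 5 1); (offset 5 1, offset 5 2); (offset 5 2, offset 5 5);
        (Reg 5, offset 5 3); (offset 5 3, offset 5 4); (offset 5 4, offset 5 5)] Skip).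

Definition strand_program : program :=
  add_vertices 2 (add_edges
    [:: (Reg 5, Reg 7); (Reg 7, offset 7 1); (offset 7 1, offset 5 5)] Skip).

Definition leaf_program : program :=
  add_vertices 1 (add_edges [:: (offset 5 2, Reg 7)] Skip).

Definition chord_program : program :=
  add_vertices 1 (add_edges
    [:: (offset 5 1, Reg 7); (offset 5 2, Reg 7); (Reg 7, offset 5 5)] Skip).

Definition advance r i := Assign r (offset r i).
Definition countdown i := Assign 4 (Defs.Sub (Reg 4) (Const i)).

(** Register 4 counts the turns of the current loop, 5 holds the number of the
    latest hub H_i with i <= f, 7 the next free number. The first loop counts
    down by two, so its last turn starts with register 4 equal to 1 or 2;
    register 6 becomes 1 exactly in the former case, that is when d - c is odd. *)
Definition network_program : program :=
  AddVertex ;;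
  Assign 4 (Defs.Sub (Reg 3) (Reg 2)) ;;
  While (Reg 4) (stage_program ;; advance 5 5 ;;
    Assign 6 (Add (Reg 6) (Defs.Sub (Const 2) (Reg 4))) ;; countdown 2) ;;
  stage_program ;;
  Assign 7 (offset 5 6) ;;
  Assign 4 (Defs.Sub (Reg 2) (Reg 1)) ;;
  While (Reg 4) (strand_program ;; advance 7 2 ;; countdown 1) ;;
  Assign 4 (Defs.Sub (Reg 0) (Const 2)) ;;
  While (Reg 4) (leaf_program ;; advance 7 1 ;; countdown 1) ;;
  Assign 4 (Defs.Sub (Reg 1) (Reg 0)) ;;
  While (Reg 4) (chord_program ;; advance 7 1 ;; countdown 1) ;;
  If (Reg 6) Skip (AddVertex ;; AddEdge (Reg 7) (Const 0)).

Lemma eval_ext m m' e : m =1 m' -> eval m e = eval m' e.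
Proof. by move=> Em; elim: e => //= e1 -> e2 ->. Qed.

Lemma runs_assign s o E r e :
  runs 1 (in_state s o E) (Assign r e)
         (in_state (set_nth 0 s r (eval (nth 0 s) e)) o E).
Proof.
move=> m b [Hm Ho HE]; exists 1, (update m r (eval m e)), b.
split=> //; first exact: ExecAssign.
by split=> // r'; rewrite /update nth_set_nth /= (eval_ext e Hm); case: eqP.
Qed.

Lemma runs_weaken t t' (P P' Q Q' : assertion) p : t <= t' ->
  (forall m b, P' m b -> P m b) -> (forall m b, Q m b -> Q' m b) ->
  runs t P p Q -> runs t' P' p Q'.
Proof.
move=> Ht HP HQ H m b /HP/H[u [m' [b' [X L /HQ Q0]]]].
by exists u, m', b'; split=> //; apply: leq_trans Ht.
Qed.

Lemma in_state_eq s s' o o' (E E' : nat * nat -> Prop) m b :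
  s = s' -> o = o' -> (forall e, E e <-> E' e) ->
  in_state s o E m b -> in_state s' o' E' m b.
Proof. by move=> <- <- HE [Hm Ho Hb]; split=> // e; rewrite -HE. Qed.

Lemma mem_new_edges (E : nat * nat -> Prop) (es es' : seq (nat * nat)) e :
  (forall e, e \in es <-> E e) -> e \in rev es' ++ es <-> E e \/ e \in es'.
Proof.
move=> HE; rewrite mem_cat mem_rev -HE orbC.
by split=> [/orP|H]; [|apply/orP].
Qed.

Section Blocks.
Variables (a0 a1 a2 a3 : nat).
Local Notation regs x z o v := [:: a0; a1; a2; a3; x; z; o; v].

Lemma runs_stage x z o v E :
  runs 11 (in_state (regs x z o v) (z + 1) E) stage_program
    (in_state (regs x z o v) (z + 6) (fun e => E e \/ e \in stage_edges z)).
Proof.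
move=> m b [Hm Ho HE]; have E5 : m 5 = z := Hm 5.
do 3 eexists; split; [by repeat econstructor | by [] |].
case: b Ho HE => o0 es0 /= Ho HE.
rewrite /= ?E5 !add_edge_new /=; try lia.
by split=> //= [|e]; [lia | apply: (mem_new_edges (stage_edges z) _ HE)].
Qed.

Lemma runs_strand z x o v E : z + 5 < v ->
  runs 5 (in_state (regs x z o v) v E) strand_program
    (in_state (regs x z o v) (v + 2) (fun e => E e \/ e \in strand_edges z v)).
Proof.
move=> Hv m b [Hm Ho HE]; have E5 : m 5 = z := Hm 5; have E7 : m 7 = v := Hm 7.
do 3 eexists; split; [by repeat econstructor | by [] |].
case: b Ho HE => o0 es0 /= Ho HE.
rewrite /= ?E5 ?E7 !add_edge_new /=; try lia.
by split=> //= [|e]; [lia | apply: (mem_new_edges (strand_edges z v) _ HE)].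
Qed.

Lemma runs_leaf z x o v E : z + 5 < v ->
  runs 2 (in_state (regs x z o v) v E) leaf_program
    (in_state (regs x z o v) (v + 1) (fun e => E e \/ e \in leaf_edges z v)).
Proof.
move=> Hv m b [Hm Ho HE]; have E5 : m 5 = z := Hm 5; have E7 : m 7 = v := Hm 7.
do 3 eexists; split; [by repeat econstructor | by [] |].
case: b Ho HE => o0 es0 /= Ho HE.
rewrite /= ?E5 ?E7 !add_edge_new /=; try lia.
by split=> //= [|e]; [lia | apply: (mem_new_edges (leaf_edges z v) _ HE)].
Qed.

Lemma runs_chord z x o v E : z + 5 < v ->
  runs 4 (in_state (regs x z o v) v E) chord_program
    (in_state (regs x z o v) (v + 1) (fun e => E e \/ e \in chord_edges z v)).
Proof.
move=> Hv m b [Hm Ho HE]; have E5 : m 5 = z := Hm 5; have E7 : m 7 = v := Hm 7.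
do 3 eexists; split; [by repeat econstructor | by [] |].
case: b Ho HE => o0 es0 /= Ho HE.
rewrite /= ?E5 ?E7 !add_edge_new /=; try lia.
by split=> //= [|e]; [lia | apply: (mem_new_edges (chord_edges z v) _ HE)].
Qed.

Lemma runs_tail x z (o : bool) v E : 0 < v ->
  runs 3 (in_state (regs x z (nat_of_bool o) v) v E)
    (If (Reg 6) Skip (AddVertex ;; AddEdge (Reg 7) (Const 0)))
    (fun m b => Defs.order b = v + ~~ o /\
       forall e, e \in edges b <-> E e \/ ~~ o /\ e = (v, 0)).
Proof.
move=> Hv m b [Hm Ho HE]; have E6 : m 6 = o := Hm 6; have E7 : m 7 = v := Hm 7.
case: o E6 {Hm} => E6.
  exists 1, m, b; split=> //; first by apply: ExecIfTrue (ExecSkip _ _); rewrite /= E6.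
  by rewrite addn0; split=> // e; rewrite HE; split=> [|[|[]]]; [left | |].
do 3 eexists; split; [apply: ExecIfFalse; [exact: E6 | by repeat econstructor] | by [] |].
case: b Ho HE => o0 es0 /= Ho HE.
rewrite /= E7 add_edge_new /=; try lia.
split=> [|e]; first lia.
rewrite (mem_new_edges [:: (v, 0)] _ HE) inE.
by split=> -[H|]; [left | move/eqP; right | left | case=> _ ->; right].
Qed.

Lemma runs_attach t0 (block : program) (es : nat -> seq (nat * nat)) z o i N v E :
  z + 5 < v ->
  (forall x o v E, z + 5 < v -> runs t0 (in_state (regs x z o v) v E) block
    (in_state (regs x z o v) (v + i) (fun e => E e \/ e \in es v))) ->
  runs (N * (t0 + 2).+1 + 1) (in_state (regs N z o v) v E)
    (While (Reg 4) (block ;; advance 7 i ;; countdown 1))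
    (in_state (regs 0 z o (v + i * N)) (v + i * N)
       (fun e => E e \/ exists2 j, j < N & e \in es (v + i * j))).
Proof.
move=> Hv Hblock.
pose I j : assertion := fun m b => j <= N /\
  in_state (regs j z o (v + i * (N - j))) (v + i * (N - j))
    (fun e => E e \/ exists2 g, g < N - j & e \in es (v + i * g)) m b.
have H : runs (N * (t0 + 2).+1 + 1) (I N)
    (While (Reg 4) (block ;; advance 7 i ;; countdown 1)) (I 0).
  apply: runs_while => [j m b [_ [Hm _ _]]|j m b [Hj HI]]; first by rewrite /= Hm.
  have Hv' : z + 5 < v + i * (N - j.+1) by apply: ltn_addr.
  have := runs_seq (Hblock _ _ _ _ Hv') (runs_seq (@runs_assign _ _ _ 7 (offset 7 i))
    (@runs_assign _ _ _ 4 (Defs.Sub (Reg 4) (Const 1)))).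
  move=> /(_ _ _ _ _ _ HI) /= [t [m' [b' [X L HQ]]]].
  exists t, m', b'; split; [exact: X | lia | split; first exact: ltnW].
  have EN : N - j = (N - j.+1).+1 by lia.
  apply: in_state_eq HQ => [||e].
  - by rewrite EN mulnS subn1 /=; congr [:: _, _, _, _, _, _, _ & _]; congr [:: _]; lia.
  - by rewrite EN mulnS; lia.
  rewrite EN; split=> [[[He|[g Hg He]]|He]|[He|[g]]].
  - by left.
  - by right; exists g => //; apply: ltnW.
  - by right; exists (N - j.+1).
  - by left; left.
  rewrite ltnS leq_eqVlt => /orP[/eqP->|Hg] He; first by right.
  by left; right; exists g.
apply: runs_weaken (leqnn _) _ _ H => m b.
  move=> HI; split=> //; rewrite subnn muln0 addn0.
  by apply: in_state_eq HI => // e; split=> [He|[//|[]//]]; left.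
by case=> _; rewrite subn0.
Qed.

End Blocks.

Lemma runs_stages a0 a1 a2 a3 e0 :
  runs (uphalf e0 * 15 + 1) (in_state [:: a0; a1; a2; a3; e0; 0; 0; 0] 1 (fun=> False))
    (While (Reg 4) (stage_program ;; advance 5 5 ;;
       Assign 6 (Add (Reg 6) (Defs.Sub (Const 2) (Reg 4))) ;; countdown 2))
    (in_state [:: a0; a1; a2; a3; 0; 5 * uphalf e0; nat_of_bool (odd e0); 0]
       (5 * uphalf e0 + 1)
       (fun e => exists2 g, g < uphalf e0 & e \in stage_edges (5 * g))).
Proof.
set F := uphalf e0.
pose I j : assertion := fun m b => exists x : nat,
  [/\ uphalf x = j, j <= F, odd x = (0 < x) && odd e0 &
      in_state [:: a0; a1; a2; a3; x; 5 * (F - j); (x == 0) && odd e0 : nat; 0]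
        (5 * (F - j) + 1)
        (fun e => exists2 g, g < F - j & e \in stage_edges (5 * g)) m b].
have H : runs (F * 15 + 1) (I F)
    (While (Reg 4) (stage_program ;; advance 5 5 ;;
       Assign 6 (Add (Reg 6) (Defs.Sub (Const 2) (Reg 4))) ;; countdown 2)) (I 0).
  apply: runs_while => [j m b [x [<- _ _ [Hm _ _]]]|j m b [x [Hx Hj Hodd HI]]].
    by rewrite /= Hm /=; lia.
  have := runs_seq (@runs_stage a0 a1 a2 a3 _ _ _ _ _)
    (runs_seq (@runs_assign _ _ _ 5 (offset 5 5))
    (runs_seq (@runs_assign _ _ _ 6 (Add (Reg 6) (Defs.Sub (Const 2) (Reg 4))))
    (@runs_assign _ _ _ 4 (Defs.Sub (Reg 4) (Const 2))))).
  move=> /(_ _ _ _ _ _ _ _ HI) /= [t [m' [b' [X L HQ]]]].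
  exists t, m', b'; split; [exact: X | exact: L | exists (x - 2)].
  have EN : F - j = (F - j.+1).+1 by lia.
  split; [lia | exact: ltnW | lia |].
  apply: in_state_eq HQ => [||e].
  - congr [:: _; _; _; _; _; _; _; _]; first by rewrite EN; lia.
    by move: Hodd; case: x Hx {HI} => [|[|[|x]]] //= Hx; lia.
  - by rewrite EN; lia.
  rewrite EN; split=> [[[g Hg He]|He]|[g]].
  - by exists g => //; apply: ltnW.
  - by exists (F - j.+1).
  rewrite ltnS leq_eqVlt => /orP[/eqP->|Hg] He; first by right.
  by left; exists g.
apply: runs_weaken (leqnn _) _ _ H => m b.
  move=> HI; exists e0; split=> //; first by case: (e0).
  apply: in_state_eq HI => [||e]; rewrite ?subnn ?muln0 //.
    by congr [:: _; _; _; _; _; _; _; _]; case: (e0).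
  by split=> // -[].
by case=> x [/eqP Hx _ _]; case: x Hx => // _; rewrite subn0.
Qed.

Theorem network_program_correct a b c d :
  3 <= a -> a <= b -> b <= c -> c <= d ->
  let f := uphalf (d - c) in let n := c - b + 2 in
  exists t m g, [/\ exec network_program (nth 0 [:: a; b; c; d]) (Build 0 [::]) t m g,
    t <= 100 * d & codes_links f n (a - 2) (b - a) (~~ odd (d - c)) g].
Proof.
move=> Ha Hab Hbc Hcd f n; set w := 5 * f + 6.
have Hv1 : 5 * f + 5 < w by rewrite /w; lia.
have Hv2 : 5 * f + 5 < w + 2 * (c - b) by rewrite /w; lia.
have Hv3 : 5 * f + 5 < w + 2 * (c - b) + 1 * (a - 2) by rewrite /w; lia.
have Hv4 : 0 < w + 2 * (c - b) + 1 * (a - 2) + 1 * (b - a) by rewrite /w; lia.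
have H0 : in_state [:: a; b; c; d; 0; 0; 0; 0] 1 (fun=> False)
    (nth 0 [:: a; b; c; d]) (add_vertex (Build 0 [::])).
  by split=> // r; do 8 (case: r => [|r] //); rewrite /= !nth_nil.
have X0 := ExecAddVertex (nth 0 [:: a; b; c; d]) (Build 0 [::]).
have [t1 [m1 [g1 [X1 L1 H1]]]] := @runs_assign _ _ _ 4 (Defs.Sub (Reg 3) (Reg 2)) _ _ H0.
have [t2 [m2 [g2 [X2 L2 H2]]]] := @runs_stages a b c d (d - c) _ _ H1.
have [t3 [m3 [g3 [X3 L3 H3]]]] := @runs_stage a b c d _ _ _ _ _ _ _ H2.
have [t4 [m4 [g4 [X4 L4 H4]]]] := @runs_assign _ _ _ 7 (offset 5 6) _ _ H3.
have [t5 [m5 [g5 [X5 L5 H5]]]] := @runs_assign _ _ _ 4 (Defs.Sub (Reg 2) (Reg 1)) _ _ H4.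
have [t6 [m6 [g6 [X6 L6 H6]]]] := runs_attach Hv1 (@runs_strand a b c d (5 * f)) H5.
have [t7 [m7 [g7 [X7 L7 H7]]]] := @runs_assign _ _ _ 4 (Defs.Sub (Reg 0) (Const 2)) _ _ H6.
have [t8 [m8 [g8 [X8 L8 H8]]]] := runs_attach Hv2 (@runs_leaf a b c d (5 * f)) H7.
have [t9 [m9 [g9 [X9 L9 H9]]]] := @runs_assign _ _ _ 4 (Defs.Sub (Reg 1) (Reg 0)) _ _ H8.
have [t10 [m10 [g10 [X10 L10 H10]]]] := runs_attach Hv3 (@runs_chord a b c d (5 * f)) H9.
have [t11 [m11 [g11 [X11 L11 [Ho HE]]]]] := @runs_tail a b c d _ _ _ _ _ Hv4 _ _ H10.
do 2 eexists; exists g11; split.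
- exact: ExecSeq X0 (ExecSeq X1 (ExecSeq X2 (ExecSeq X3 (ExecSeq X4 (ExecSeq X5
    (ExecSeq X6 (ExecSeq X7 (ExecSeq X8 (ExecSeq X9 (ExecSeq X10 X11)))))))))).
- by move: L1 L2 L3 L4 L5 L6 L7 L8 L9 L10 L11 => /=; lia.
have En : c - b = n - 2 by rewrite /n; lia.
split=> [|e]; first by rewrite Ho /vertex_count /w; lia.
have n_gt1 : 1 < n by rewrite /n; lia.
apply: (iff_trans (HE e)).
apply: (iff_trans _ (edge_codesP f (a - 2) (b - a) (~~ odd (d - c)) e n_gt1)).
rewrite /edge_codes -En -/w !mul1n.
have Estage : (exists2 i, i < f.+1 & e \in stage_edges (5 * i)) <->
    (exists2 i, i < f & e \in stage_edges (5 * i)) \/ e \in stage_edges (5 * f).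
  split=> [[i]|[[i Hi He]|He]].
  - by rewrite ltnS leq_eqVlt => /orP[/eqP->|Hi He]; [right | left; exists i].
  - by exists i => //; apply: ltnW.
  by exists f.
have Eleaf v : (exists2 j, j < a - 2 & e \in leaf_edges (5 * f) (v + 1 * j)) <->
    (exists2 m, m < a - 2 & e \in leaf_edges (5 * f) (v + m)).
  by split=> -[j Hj He]; exists j; rewrite // ?mul1n in He *.
have Echord v : (exists2 j, j < b - a & e \in chord_edges (5 * f) (v + 1 * j)) <->
    (exists2 m, m < b - a & e \in chord_edges (5 * f) (v + m)).
  by split=> -[j Hj He]; exists j; rewrite // ?mul1n in He *.
rewrite Estage; have := Eleaf (w + 2 * (c - b)); have := Echord (w + 2 * (c - b) + (a - 2)).
tauto.
Qed.

Theorem corollary14 :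
  exists (p : program) (C : nat),
    forall a b c d : nat, 3 <= a -> a <= b -> b <= c -> c <= d ->
      exists (t : nat) (G : sgraph),
        [/\ constructs_in p [:: a; b; c; d] t G, t <= C * d & connected G] /\
        [/\ geodetic_number G a, edge_geodetic_number G b,
            strong_edge_geodetic_number G c & meg_number G d].
Proof.
exists network_program, 100 => a b c d Ha Hab Hbc Hcd.
have [t [m [g [X Ht Hg]]]] := network_program_correct Ha Hab Hbc Hcd.
have n_gt1 : 1 < c - b + 2 by lia.
have q_gt0 : 0 < a - 2 by lia.
have root_low : ~~ odd (d - c) || (0 < uphalf (d - c)) by lia.
have [N] := network_of_codes n_gt1 Hg.
exists t, (graph_of g); split.
  split=> //; first by exists m, g.
  exact: network_connected root_low N.
have [Hgeo Hedge Hstrong Hmeg] := network_numbers n_gt1 q_gt0 root_low N.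
have Ea : a - 2 + 2 = a by lia.
have Eb : a - 2 + (b - a) + 2 = b by lia.
have Ec : a - 2 + (b - a) + (c - b + 2) = c by lia.
have Ed : ~~ odd (d - c) + 2 * uphalf (d - c) + (a - 2) + (b - a) + (c - b + 2).-1 = d by lia.
by rewrite Ea in Hgeo; rewrite Eb in Hedge; rewrite Ec in Hstrong; rewrite Ed in Hmeg.
Qed.
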